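(* Let $A$ be a semisimple Banach algebra and let $a,b\in \mathrm{Soc}(A)$. If $\rho(a,b)=0$, then $\mathrm{tr}(a)=\mathrm{tr}(b)$.
   Context: Banach algebras are over $\mathbb{C}$ and have a unit $1$; $\sigma(x)$ is the spectrum of $x\in A$ and $\sigma'(x)=\sigma(x)\setminus\{0\}$. For $a,b\in A$ let $C_{a,b}:A\to A$ be the bounded operator $C_{a,b}x=ax-xb$, and put $\rho(a,b)=\limsup_{n\to\infty}\|C_{a,b}^n1\|^{1/n}$. $\mathrm{Soc}(A)$ (the socle) is the two-sided ideal of all finite sums of rank one elements, where $0\neq u\in A$ is rank one if $uAu\subseteq\mathbb{C}u$ (the zero element is included as the empty sum); every element of $\mathrm{Soc}(A)$ has finite spectrum. For $a\in A$ let $\mathrm{rank}(a)=\sup_{x\in A}\#\sigma'(xa)\le\infty$, where $\#K$ is the number of distinct elements of $K\subseteq\mathbb{C}$. For $a\in\mathrm{Soc}(A)$ the rank is finite and $E(a)=\{x\in A:\#\sigma'(xa)=\mathrm{rank}(a)\}$ is open and dense in $A$. Multiplicity (Aupetit–Mouton): for $a\in\mathrm{Soc}(A)$ and $\lambda\in\sigma(a)$, let $V_\lambda$ be an open disk centered at $\lambda$ whose closure contains no other point of $\sigma(a)$. There is an open ball $U\subset A$ centered at $1$ such that $\#[\sigma(xa)\cap V_\lambda]$ is constant for $x\in E(a)\cap U$; this constant is the multiplicity $m(\lambda,a)$ of $a$ at $\lambda$. Trace: $\mathrm{tr}(a)=\sum_{\lambda\in\sigma(a)}\lambda\,m(\lambda,a)$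 for $a\in\mathrm{Soc}(A)$. *)

(* Defs.v *)
From HB Require Import structures.
From mathcomp Require Import all_boot all_order all_algebra.
From mathcomp Require Import all_classical all_reals all_analysis.
From mathcomp Require Export complex.

Set Implicit Arguments.
Unset Strict Implicit.
Unset Printing Implicit Defensive.

Import Order.TTheory GRing.Theory Num.Theory.
Import numFieldNormedType.Exports.

Local Open Scope classical_set_scope.
Local Open Scope ring_scope.

(* The ring operations are fields of the mixin, and the library's ring
   structures are attached to [BanachAlgebra.sort] afterwards: Hierarchy-Builder
   rejects a structure extending both [CompleteNormedModule K] and [NzRing],
   because it would be a missing join below [Num.NumDomain].
   The unit is nonzero, but its norm is not required to be 1. *)
HB.mixin Record isBanachAlgebra (K : numFieldType) A
    & CompleteNormedModule K A := {
  bone : A;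
  bmul : A -> A -> A;
  bmulA : associative bmul;
  bmul1x : left_id bone bmul;
  bmulx1 : right_id bone bmul;
  bmulDl : left_distributive bmul +%R;
  bmulDr : right_distributive bmul +%R;
  bone_neq0 : bone != 0;
  bscaleAl : forall (k : K) (x y : A), k *: bmul x y = bmul (k *: x) y;
  bscaleAr : forall (k : K) (x y : A), k *: bmul x y = bmul x (k *: y);
  bnormM : forall x y : A, `|bmul x y| <= `|x| * `|y|
}.

#[short(type="banachAlgType")]
HB.structure Definition BanachAlgebra (K : numFieldType) :=
  {A of CompleteNormedModule K A & isBanachAlgebra K A}.

Section BanachAlgebraRing.
Variables (K : numFieldType) (A : banachAlgType K).

HB.instance Definition _ := GRing.Zmodule_isNzRing.Build (BanachAlgebra.sort A)
  (@bmulA K A) (@bmul1x K A) (@bmulx1 K A) (@bmulDl K A) (@bmulDr K A)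
  (@bone_neq0 K A).

HB.instance Definition _ := GRing.Lmodule_isLalgebra.Build K
  (BanachAlgebra.sort A) (@bscaleAl K A).

HB.instance Definition _ := GRing.Lalgebra_isAlgebra.Build K
  (BanachAlgebra.sort A) (@bscaleAr K A).

Let inverses (x : A) : set A := [set y | y * x = 1 /\ x * y = 1].
Let bunit : pred A := fun x => `[< inverses x !=set0 >].
Let binv (x : A) : A := xget x (inverses x).

Let binvP : {in bunit, forall x, inverses x (binv x)}.
Proof. by move=> x /asboolP[y xy]; exact: (xgetPex x (ex_intro _ y xy)). Qed.

Let bmulVx : {in bunit, left_inverse 1 binv *%R}.
Proof. by move=> x /binvP[]. Qed.

Let bmulxV : {in bunit, right_inverse 1 binv *%R}.
Proof. by move=> x /binvP[]. Qed.

Let bunitP (x y : A) : y * x = 1 /\ x * y = 1 -> bunit x.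
Proof. by move=> xy; apply/asboolP; exists y. Qed.

Let binv_out : {in [predC bunit], binv =1 id}.
Proof.
move=> x /negP xU; apply: xgetPN => y xy.
by apply: xU; apply: bunitP xy.
Qed.

HB.instance Definition _ := GRing.NzRing_hasMulInverse.Build
  (BanachAlgebra.sort A) bmulVx bmulxV bunitP binv_out.

Lemma ler_normBM (x y : A) : `|x * y| <= `|x| * `|y|.
Proof. exact: bnormM. Qed.

End BanachAlgebraRing.

Section BanachAlgebraNotions.
Context {R : realType} {A : banachAlgType R[i]}.
Implicit Types (a b u x : A) (I M : set A) (l r e : R[i]) (m : nat).

Definition left_ideal I : Prop :=
  [/\ I 0, (forall x y : A, I x -> I y -> I (x + y))
    & (forall z x : A, I x -> I (z * x))].

Definition maximal_left_ideal M : Prop :=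
  [/\ left_ideal M, M != setT
    & forall I, left_ideal I -> M `<=` I -> I = M \/ I = setT].

Definition jacobson_radical : set A :=
  [set x | forall M, maximal_left_ideal M -> M x].

Definition semisimple : Prop := jacobson_radical = [set 0].

Definition spectrum a : set R[i] := [set l | l%:A - a \isn't a GRing.unit].

Definition spectrum' a : set R[i] := spectrum a `\ 0.

Definition rank_one u : Prop :=
  u != 0 /\ forall x, exists l, u * x * u = l *: u.

Definition socle : set A :=
  [set a | exists s : seq A,
     (forall u, u \in s -> rank_one u) /\ a = \sum_(u <- s) u].

(* Extended-real valued, so that infinite sets and unbounded families of
   cardinals have rank [+oo]. *)
Definition rank a : \bar R :=
  ereal_sup [set counting (spectrum' (x * a)) | x in [set: A]].

Definition rank_attained a : set A :=
  [set x | counting (spectrum' (x * a)) = rank a].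

(* Radii live in [R[i]], where [0 < r] says that [r] is a positive real. *)
Definition isolating_radius a l r : Prop :=
  0 < r /\ closure (ball (l : R[i]^o) r) `&` spectrum a `<=` [set l].

Definition is_multiplicity l a m : Prop :=
  forall r, isolating_radius a l r ->
  exists2 e : R[i], 0 < e & forall x, rank_attained a x -> ball (1 : A) e x ->
    counting (spectrum (x * a) `&` ball (l : R[i]^o) r) = m%:R%:E :> \bar R.

(* For [a] in the socle of a semisimple algebra and [l] in its spectrum there
   is exactly one such [m]; the value is irrelevant otherwise. *)
Definition multiplicity l a : nat := xget 0%N [set m | is_multiplicity l a m].

(* Summation over a finite set: the socle elements have finite spectrum. *)
Definition trace a : R[i] :=
  \sum_(l \in spectrum a) l * (multiplicity l a)%:R.

Definition comm_op a b : A -> A := fun x => a * x - x * b.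

(* Norms of [A] are valued in [R[i]]; they are real, whence the [Re]. *)
Definition rho a b : \bar R :=
  limn_esup (fun n : nat =>
    (complex.Re `|iter n (comm_op a b) 1| `^ n%:R^-1)%:E).

End BanachAlgebraNotions.

Arguments semisimple {R} A.
Arguments socle {R} A.

(* Main.v *)
Require Import Defs.
From mathcomp Require Import all_boot all_order all_algebra all_field.
From mathcomp Require Import all_classical all_reals all_analysis.
From mathcomp Require Import finmap ring.

(** Why the theorem holds.

    Let T x = a x - x b. If a and b are algebraic, then T is annihilated at 1
    by a product of factors whose roots are differences of eigenvalues of a and
    of b. A vector on which the powers of T decay faster than every geometric
    sequence cannot produce an eigenvector of T with a nonzero eigenvalue, so
    rho(a, b) = 0 forces T^N 1 = 0 for some N ([superexponential_nilpotent]).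
    The expansion of f(a) around b for noncommuting a and b,
      f(a) = sum_(k < N) (T^k 1) f^(k)(b) / k!
    ([noncommutative_taylor]) then shows f(a) = f(b) for every polynomial f
    whose derivatives vanish to high order at the eigenvalues of b. By Hermite
    interpolation f can also be chosen to fix all eigenvalues of a and of b and
    0; f(a) and f(b) are then the semisimple parts of a and b, and they
    coincide. It remains to see that passing from a to f(a) preserves the trace.

    The spectral trace becomes a matrix trace as follows. An element of the
    socle is a sum of products c_i d_i with c_i in A p_i and d_i in p_i A, where
    the p_i are minimal idempotents, any two of them being equal or satisfying
    p_i A p_j = 0; such data are called a frame below. Minimality means
    p A p = C p, so d_i x c_j is a scalar multiple of p_j, and these scalars
    form a matrix M(x). For a = sum_i c_i d_i, the nonzero spectrum of x a is
    the set of nonzero eigenvalues of M(x) ([frame_spectrum]): this is the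
    familiar comparison of the spectra of RS and SR. When the c_i and the d_i
    are linearly independent, M(x) can be any diagonal matrix
    ([frame_mx_diag], a density theorem), hence rank(a) is the size of M, and
    E(a) consists of those x for which M(x) has distinct nonzero eigenvalues.
    Such x are dense near 1 because a discriminant has isolated zeros, and roots
    of a polynomial depend continuously on it; so for nonzero l the multiplicity
    m(l, a) is the multiplicity of l as a root of the characteristic polynomial
    of M(1), and tr(a) is the trace of M(1) ([trace_minimal]). Any frame can be
    reduced to an independent one without changing a or the trace of M(1)
    ([frame_minimal]), whence tr(a) = tr M(1) for every frame ([trace_frame]).
    Finally a frame of a yields a frame of f(a) whose matrix is f(M(1)), and
    M(1) - f(M(1)) is nilpotent, so both have the same trace. *)

Set Implicit Arguments.
Unset Strict Implicit.
Unset Printing Implicit Defensive.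

Import Order.TTheory GRing.Theory Num.Theory.
Import numFieldNormedType.Exports.

Local Open Scope classical_set_scope.
Local Open Scope ring_scope.

(** * Polynomials: continuity of roots *)

(** Synthetic division read from the top: g_(k-1) = e_k + w g_k, where the e_k are
    the coefficients of the product, so each step multiplies the bound by at most 1 + B. *)
Lemma ler_coef_divXsubC (K : numFieldType) (w B e : K) (g : {poly K}) (n : nat) :
  `|w| <= B -> 0 <= e -> (size g <= n)%N ->
  (forall i, `|(('X - w%:P) * g)`_i| <= e) ->
  forall i, `|g`_i| <= e * (1 + B) ^+ n.
Proof.
move=> wB e0 sg he.
have B0 : 0 <= B by apply: le_trans wB.
have B1 : 1 <= 1 + B by rewrite lerDl.
suff H k i : (n <= i + k)%N -> `|g`_i| <= e * (1 + B) ^+ k.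
  move=> i; apply: H; exact: leq_addl.
elim: k i => [|k IH] i hi.
  by rewrite nth_default ?normr0 ?mulr1// (leq_trans sg)// -(addn0 i).
have -> : g`_i = (('X - w%:P) * g)`_i.+1 + w * g`_i.+1.
  by rewrite mulrBl coefB coefXM coefCM subrK.
apply: (le_trans (ler_normD _ _)); rewrite normrM exprS mulrA mulrDr mulr1 mulrDl.
apply: lerD; first by rewrite (le_trans (he _))// ler_peMr// exprn_ege1.
by rewrite mulrAC [leRHS]mulrC ler_pM// IH// addSnnS.
Qed.

Lemma ler_horner_coef_bound (K : numFieldType) (p : {poly K}) (n : nat) (d z : K) :
  (size p <= n)%N -> (forall i, `|p`_i| <= d) ->
  `|p.[z]| <= d * \sum_(i < n) `|z| ^+ i.
Proof.
move=> sp hd; rewrite (horner_coef_wide _ sp) mulr_sumr.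
apply: (le_trans (ler_norm_sum _ _ _)); apply: ler_sum => i _.
by rewrite normrM normrX ler_wpM2r ?exprn_ge0.
Qed.

(** A product of numbers that are all at least e cannot be smaller than a power
    of e. *)
Lemma exists_close_root (K : numFieldType) (z e : K) (ws : seq K) :
  0 < e -> `|(\prod_(w <- ws) ('X - w%:P)).[z]| < e ^+ size ws ->
  exists2 w, w \in ws & `|z - w| < e.
Proof.
move=> e0; elim: ws => [|w ws IH].
  by rewrite big_nil hornerC normr1 expr0 ltxx.
rewrite big_cons hornerM hornerXsubC normrM /= exprS => h.
have [we|] := real_ltP (normr_real (z - w)) (gtr0_real e0).
  by exists w; rewrite ?mem_head.
move=> ew; have [|v vw ve] := IH; last by exists v; rewrite // inE vw orbT.
rewrite -(ltr_pM2l e0); apply: le_lt_trans h; exact: ler_wpM2r.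
Qed.

Lemma exists_pos_le2 (K : numFieldType) (x y : K) : 0 < x -> 0 < y ->
  exists e, [/\ 0 < e, e <= x & e <= y].
Proof.
move=> x0 y0; exists (x^-1 + y^-1)^-1.
have h : 0 < x^-1 + y^-1 by rewrite addr_gt0// invr_gt0.
rewrite invr_gt0; split=> //.
  by rewrite invf_ple ?posrE// lerDl invr_ge0 ltW.
by rewrite invf_ple ?posrE// lerDr invr_ge0 ltW.
Qed.

(** Induction on the roots: a polynomial Q close to P = (X - z) P' is small at z, so
    it has a root w near z. Dividing X - z out of P and X - w out of Q keeps the
    coefficients close, because
    (X - w)(P' - Q') = (P - Q) - (w - z) P' and P' is fixed. *)
Lemma roots_continuity (K : numFieldType) (zs : seq K) (e : K) : 0 < e ->
  exists2 d : K, 0 < d & forall ws, size ws = size zs ->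
  (forall i, `|(\prod_(z <- zs) ('X - z%:P) - \prod_(w <- ws) ('X - w%:P))`_i|
     <= d) ->
  exists2 ws', perm_eq ws ws' & all2 (fun z w => `|z - w| < e) zs ws'.
Proof.
elim: zs e => [|z zs IH] e e0.
  by exists 1 => // -[|//] _ _; exists [::].
have [d' d'0 Hd'] := IH _ e0.
set P := \prod_(z <- zs) ('X - z%:P).
set n := size zs.
pose C := \sum_(i < n.+1) `|P`_i|.
have C0 : 0 <= C by apply: sumr_ge0.
have sP : size P = n.+1 by rewrite size_prod_XsubC.
have hC i : `|P`_i| <= C.
  have [iP|iP] := ltnP i n.+1; last by rewrite nth_default ?sP// normr0.
  by rewrite /C (bigD1 (Ordinal iP))//= lerDl sumr_ge0.
pose B := `|z| + 1; have B0 : 0 <= B by rewrite addr_ge0.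
pose G := (1 + B) ^+ n.+1; have G0 : 0 < G by rewrite exprn_gt0// ltr_pwDl.
have C1 : 0 < C + 1 by rewrite ltr_wpDl.
have [e1 [e10 e1e e1d]] : exists e1, [/\ 0 < e1, e1 <= e & e1 <= d' / (2 * (C + 1) * G)].
  by apply: exists_pos_le2 => //; rewrite divr_gt0// !mulr_gt0.
have [e2 [e20 e21 e22]] := exists_pos_le2 e10 (ltr01 : 0 < 1 :> K).
pose S := \sum_(i < n.+2) `|z| ^+ i.
have S0 : 0 <= S by apply: sumr_ge0 => i _; apply: exprn_ge0.
have [d [d0 dd1 dd2]] : exists d, [/\ 0 < d, d <= e2 ^+ n.+1 / (S + 1) & d <= d' / (2 * G)].
  have S1 : 0 < S + 1 by rewrite ltr_wpDl.
  apply: exists_pos_le2; apply: divr_gt0 => //.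
    exact: exprn_gt0.
  exact: mulr_gt0.
exists d => // ws sws hws.
set Q := \prod_(w <- ws) _ in hws.
rewrite big_cons -/P in hws.
have sQ : size Q = n.+2 by rewrite size_prod_XsubC sws.
have Qz : `|Q.[z]| < e2 ^+ size ws.
  have -> : Q.[z] = - (('X - z%:P) * P - Q).[z].
    by rewrite !hornerE subrr mul0r sub0r opprK.
  rewrite normrN; apply: (@le_lt_trans _ _ (d * S)).
    apply: ler_horner_coef_bound => //.
    rewrite (leq_trans (size_polyD _ _))// size_polyN sQ geq_max leqnn andbT.
    by have := size_prod_XsubC (z :: zs) id; rewrite big_cons => ->.
  rewrite sws -/n; apply: (@lt_le_trans _ _ (d * (S + 1))).
    by rewrite ltr_pM2l// ltrDl.
  by rewrite -ler_pdivlMr// ltr_wpDl.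
have [w ww zw] := exists_close_root e20 Qz.
set us := rem w ws.
have pws : perm_eq ws (w :: us) by apply: perm_to_rem.
set Q' := \prod_(u <- us) ('X - u%:P).
have QE : Q = ('X - w%:P) * Q' by rewrite /Q (perm_big _ pws) big_cons.
have sus : size us = n by rewrite size_rem// sws.
have sQ' : size Q' = n.+1 by rewrite size_prod_XsubC sus.
have [|vs pvs avs] := Hd' us sus; last first.
  exists (w :: vs); first by rewrite (perm_trans pws)// perm_cons.
  by rewrite /= avs andbT (lt_le_trans zw)// (le_trans e21).
have zw' : `|z - w| <= e2 := ltW zw.
have wB : `|w| <= B.
  rewrite -[w](subKr z) (le_trans (ler_normB _ _))// /B lerD2l.
  exact: le_trans zw' e22.
(* Here P and Q' are the quotients by X - z and X - w. *)
have hd i : `|(('X - w%:P) * (P - Q'))`_i| <= d + e2 * C.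
  have -> : ('X - w%:P) * (P - Q') = ('X - z%:P) * P - Q + (z - w)%:P * P.
    by rewrite QE polyCB mulrBr !mulrBl; ring.
  rewrite coefD coefCM (le_trans (ler_normD _ _))// lerD// normrM.
  by apply: ler_pM.
move=> i.
apply: (le_trans (ler_coef_divXsubC wB _ _ hd (n := n.+1) i)).
- by apply: addr_ge0; [exact: ltW | apply: mulr_ge0 => //; exact: ltW].
- rewrite (leq_trans (size_polyD _ _))// size_polyN sP sQ' maxnn//.
rewrite -/G mulrDl.
have -> : d' = d' / 2 + d' / 2 by rewrite -splitr.
apply: lerD.
  rewrite (le_trans (ler_wpM2r (ltW G0) dd2))//.
  by rewrite invfM -!mulrA mulVf ?mulr1// gt_eqF.
apply: (@le_trans _ _ (d' / (2 * (C + 1) * G) * (C + 1) * G)).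
  rewrite ler_pM2r//; apply: ler_pM => //; first exact: ltW.
    by rewrite (le_trans e21).
  by rewrite lerDl.
suff -> : d' / (2 * (C + 1) * G) * (C + 1) * G = d' / 2 by [].
by field; rewrite !gt_eqF.
Qed.

(** * Characteristic polynomials, interpolation and divisibility *)

Lemma char_poly_split (K : closedFieldType) n (M : 'M[K]_n) :
  exists2 rs, size rs = n & char_poly M = \prod_(r <- rs) ('X - r%:P).
Proof.
have [rs hrs] := closed_field_poly_normal (char_poly M).
have hE : char_poly M = \prod_(r <- rs) ('X - r%:P).
  by rewrite {1}hrs (monicP (char_poly_monic M)) scale1r.
exists rs => //; apply/eqP; rewrite -eqSS -(size_prod_XsubC _ id) -hE.
by rewrite size_char_poly.
Qed.

Lemma mxtrace_sum_roots (K : fieldType) n (M : 'M[K]_n) (rs : seq K) :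
  char_poly M = \prod_(r <- rs) ('X - r%:P) -> \tr M = \sum_(r <- rs) r.
Proof.
move=> hE; have srs : size rs = n.
  by apply/eqP; rewrite -eqSS -(size_prod_XsubC _ id) -hE size_char_poly.
case: n => [|n] in M hE srs *.
  by rewrite (size0nil srs) big_nil /mxtrace big_ord0.
have := coefPn_prod_XsubC (ps := rs); rewrite srs -hE => /(_ isT).
by rewrite char_poly_trace// => /oppr_inj.
Qed.

Lemma mxtrace_nilpotent (K : closedFieldType) n (M : 'M[K]_n.+1) k :
  M ^+ k = 0 -> \tr M = 0.
Proof.
move=> Mk; have [rs _ hE] := char_poly_split M.
rewrite (mxtrace_sum_roots hE) big_seq big1 // => r rrs.
have : eigenvalue M r by rewrite eigenvalue_root_char hE root_prod_XsubC.
move=> /eigenvalueP[v vM v0].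
have : v *m M ^+ k = r ^+ k *: v.
  elim: k {Mk} => [|k IH]; first by rewrite !expr0 mulmx1 scale1r.
  by rewrite exprSr mulmxA IH -scalemxAl vM scalerA exprSr.
rewrite Mk mulmx0 => /esym/eqP; rewrite scaler_eq0 (negPf v0) orbF.
by rewrite expf_eq0 => /andP[_ /eqP].
Qed.

(** One node at a time: (X - r)^m and the product of the previous (X - s)^m are
    coprime, and a Bezout relation corrects f at r without disturbing it at the
    other nodes. *)
Lemma hermite_interpolation (K : fieldType) (rs : seq K) (m : nat) :
  uniq rs -> exists f : {poly K},
    forall r, r \in rs -> ('X - r%:P) ^+ m %| f - r%:P.
Proof.
elim: rs => [_|r rs IH /= /andP[rrs /IH [f hf]]]; first by exists 0.
pose G := \prod_(s <- rs) ('X - s%:P).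
have cop : coprimep (('X - r%:P) ^+ m) (G ^+ m).
  by rewrite coprimep_expl// coprimep_expr// coprimep_sym coprimep_XsubC root_prod_XsubC.
have /Bezout_eq1_coprimepP[[u v] /= uv] := cop.
exists (f + (r%:P - f) * (v * G ^+ m)) => s; rewrite inE => /predU1P[->|srs].
  have -> : f + (r%:P - f) * (v * G ^+ m) - r%:P = (f - r%:P) * u * ('X - r%:P) ^+ m.
    have -> : v * G ^+ m = 1 - u * ('X - r%:P) ^+ m by rewrite -uv addrC addKr.
    by set P := _ ^+ m; ring.
  exact: dvdp_mulIr.
rewrite addrAC dvdp_add ?hf// !dvdp_mull// dvdp_exp2r//.
by rewrite dvdp_XsubCl root_prod_XsubC.
Qed.

(** Separability of X p says at once that the roots of p are simple and nonzero. On
    the line through M and N it is the nonvanishing of a resultant, a polynomial in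
    the parameter t that is nonzero at t = 1. The factor X also keeps the
    derivative nonzero for n = 0, so that the resultant specializes well. *)
Lemma separable_generic (K : numFieldType) n (M N : 'M[K]_n) :
  separable_poly ('X * char_poly N) ->
  exists2 D : {poly K}, D != 0 & forall t, ~~ root D t ->
    separable_poly ('X * char_poly (M + t *: (N - M))).
Proof.
move=> sepN.
pose L : 'M[{poly K}]_n := map_mx polyC M + 'X *: map_mx polyC (N - M).
pose Q := 'X * char_poly L.
have LE t : map_mx (horner_eval t) L = M + t *: (N - M).
  by apply/matrixP => i j; rewrite !mxE /horner_eval !hornerE.
have QE t : map_poly (horner_eval t) Q = 'X * char_poly (M + t *: (N - M)).
  by rewrite rmorphM /= map_polyX map_char_poly LE.
have mQ : Q \is monic by rewrite monicMl ?monicX// char_poly_monic.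
have sQ : size Q = n.+2.
  by rewrite size_monicM ?monicX ?monic_neq0 ?char_poly_monic// size_polyX size_char_poly.
have lQ' : lead_coef Q^`() = n.+1%:R.
  have c : Q^`()`_n = n.+1%:R.
    by rewrite coef_deriv; have := monicP mQ; rewrite lead_coefE sQ => ->.
  have nz : n.+1%:R != 0 :> {poly K} by rewrite -polyC_natr polyC_eq0 pnatr_eq0.
  rewrite lead_coefE; suff -> : size Q^`() = n.+1 by [].
  apply/eqP; rewrite eqn_leq -ltnS -sQ lt_size_deriv ?monic_neq0//=.
  by apply: contraLR nz; rewrite -leqNgt => h; rewrite negbK -c nth_default.
have res t : horner_eval t (resultant Q Q^`()) =
   resultant ('X * char_poly (M + t *: (N - M))) ('X * char_poly (M + t *: (N - M)))^`().
  rewrite map_resultant -?deriv_map ?QE//.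
    by rewrite (monicP mQ) rmorph1 oner_neq0.
  by rewrite lQ' rmorph_nat pnatr_eq0.
have sepE (N' : 'M[K]_n) (p := 'X * char_poly N') :
    separable_poly p = (resultant p p^`() != 0).
  rewrite unlock resultant_eq0 coprimep_def -leqNgt eqn_leq size_poly_gt0.
  by rewrite gcdp_eq0 mulf_eq0 polyX_eq0 (negPf (monic_neq0 (char_poly_monic _))) andbT.
exists (resultant Q Q^`()).
  apply/eqP => D0; have := sepN; rewrite sepE -[N](subrK M) addrC -[N - M]scale1r.
  by rewrite -res D0 rmorph0 eqxx.
by move=> t; rewrite /root -[_.[t]]/(horner_eval t _) res -sepE.
Qed.

Lemma exists_small_nonroot (K : numFieldType) (D : {poly K}) (e : K) :
  D != 0 -> 0 < e -> exists2 t, `|t| < e & ~~ root D t.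
Proof.
move=> D0 e0; pose f (i : nat) : K := e / i.+2%:R.
pose ts := [seq f i | i <- iota 0 (size D)].
have fI : injective f.
  move=> i j /(mulfI (lt0r_neq0 e0)) /invr_inj /eqP.
  by rewrite eqr_nat => /eqP[].
have uts : uniq ts by rewrite map_inj_uniq ?iota_uniq.
have [h|/allPn[t /mapP[i _ ->] ht]] := boolP (all (root D) ts).
  by have := max_poly_roots D0 h uts; rewrite size_map size_iota ltnn.
exists (f i) => //; rewrite ger0_norm ?divr_ge0 ?ltW//.
by rewrite ltr_pdivrMr// ltr_pMr// ltr1n.
Qed.

Lemma dvdp_prod_XsubC_pow (K : fieldType) (rs : seq K) (g : {poly K}) :
  (forall r, r \in rs -> ('X - r%:P) ^+ size rs %| g) ->
  \prod_(r <- rs) ('X - r%:P) %| g.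
Proof.
move=> H.
have {H} : forall r, r \in rs -> ('X - r%:P) ^+ count_mem r rs %| g.
  by move=> r /H; apply: dvdp_trans; apply: dvdp_exp2l; apply: count_size.
elim: rs g => [|r rs IH] g H; first by rewrite big_nil dvd1p.
have := H r (mem_head _ _); rewrite /= eqxx exprS => rg.
have /dvdpP[h gE] : 'X - r%:P %| g by apply: dvdp_trans rg; apply: dvdp_mulr.
rewrite big_cons gE [h * _]mulrC dvdp_mul2l ?polyXsubC_eq0//.
apply: IH => s srs; have := H s; rewrite inE srs orbT => /(_ isT) /=.
rewrite gE; case: eqVneq => [->|rs'].
  by rewrite exprS mulrC dvdp_mul2r ?polyXsubC_eq0.
rewrite add0n Gauss_dvdpl// coprimep_expl// coprimep_XsubC2//.
by rewrite subr_eq0.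
Qed.

(** Each derivative costs one factor X - r; characteristic zero allows the division
    by k!. *)
Lemma dvdp_nderivn (K : numFieldType) (r : K) (g : {poly K}) (m k : nat) :
  ('X - r%:P) ^+ (m + k) %| g -> ('X - r%:P) ^+ m %| g^`N(k).
Proof.
have D i (h : {poly K}) : ('X - r%:P) ^+ i.+1 %| h -> ('X - r%:P) ^+ i %| h^`().
  move=> /dvdpP[u ->]; rewrite derivM dvdp_add//.
    by rewrite exprS mulrA dvdp_mulIr.
  by rewrite deriv_exp derivXsubC mul1r -mulr_natl !dvdp_mull.
have Dn h : ('X - r%:P) ^+ (m + k) %| h -> ('X - r%:P) ^+ m %| h^`(k).
  elim: k h => [|k IH] h; first by rewrite addn0.
  by rewrite addnS => /D /IH; rewrite -derivSn.
by move=> /Dn; rewrite nderivn_def -scaler_nat dvdpZr ?pnatr_eq0 -?lt0n ?fact_gt0.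
Qed.

Section Taylor.
Variables (K : fieldType) (A : algType K) (a b : A).
Local Notation T := (fun x : A => a * x - x * b).

(** Left multiplication by a is T plus right multiplication by b, and the last two
    commute: this is the Taylor expansion of f at the right multiplication by b,
    applied to 1 and truncated since T is nilpotent there. *)
Lemma noncommutative_taylor (N : nat) (f : {poly K}) : iter N.+1 T 1 = 0 ->
  horner_alg a f = \sum_(k < N.+1) iter k T 1 * horner_alg b f^`N(k).
Proof.
move=> TN; elim/poly_ind: f => [|g c IH].
  by rewrite rmorph0 big1// => k _; rewrite linear0 rmorph0 mulr0.
rewrite rmorphD rmorphM /= horner_algX horner_algC.
have -> : horner_alg a g * a = a * horner_alg a g.
  by rewrite -{2 3}[a](horner_algX a) -!rmorphM /= mulrC.
rewrite big_ord_recl /= nderivn0 rmorphD rmorphM /= horner_algX horner_algC mul1r.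
rewrite addrAC; congr (_ + _).
under [X in _ + X]eq_bigr do rewrite nderivnMXaddC rmorphD rmorphM /= horner_algX mulrDr.
rewrite big_split /= IH mulr_sumr.
transitivity (\sum_(k < N.+1) (iter k.+1 T 1 * horner_alg b g^`N(k) +
    iter k T 1 * (horner_alg b g^`N(k) * b))).
  apply: eq_bigr => k _; rewrite iterS mulrBl -!mulrA.
  have -> : b * horner_alg b g^`N(k) = horner_alg b g^`N(k) * b.
    by rewrite -{1 4}[b](horner_algX b) -!rmorphM /= mulrC.
  by rewrite subrK.
rewrite big_split /= big_ord_recr /= [X in _ + X]big_ord_recl /=.
move: TN => /= ->; rewrite mul0r addr0.
by rewrite nderivn0 mul1r addrCA.
Qed.

End Taylor.

(** * Frames of minimal idempotents *)

(** Independent linear forms have a dual family of vectors. As V may be infinite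
    dimensional, finitely many vectors are chosen on which the forms have the
    largest possible rank; a rank below n would leave a nonzero relation in the
    cokernel, valid on all of V. *)
Lemma linear_dual (K : fieldType) (V : lmodType K) n (f : 'I_n -> V -> K) :
  (forall j, linear (f j : V -> K^o)) ->
  (forall t : 'I_n -> K, (forall y, \sum_j t j * f j y = 0) -> forall j, t j = 0) ->
  exists y : 'I_n -> V, forall i j, f j (y i) = (i == j)%:R.
Proof.
move=> flin findep.
pose F y : 'rV[K]_n := \row_j f j y.
have Flin k x y : F (k *: x + y) = k *: F x + F y.
  by apply/rowP => j; rewrite !mxE flin.
have Fsum m (w : 'I_m -> K) (y : 'I_m -> V) :
    F (\sum_i w i *: y i) = \sum_i w i *: F (y i).
  elim/big_rec2: _ => [|i u v _ IH]; last by rewrite Flin IH.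
  by have := Flin (-1) 0 0; rewrite scaler0 addr0 scaleN1r addNr.
pose P (k : nat) := `[< exists m (y : 'I_m -> V), \rank (\matrix_i F (y i)) = k >].
have Pn k : P k -> (k <= n)%N by move=> /asboolP[m [y <-]]; exact: rank_leq_col.
have P0 : exists k, P k.
  by eexists; apply/asboolP; exists 0%N, (fun=> 0).
case: (ex_maxnP P0 Pn) => k /asboolP[m [y yk]] kmax.
set M := \matrix_i F (y i) in yk.
have FM x : (F x <= M)%MS.
  pose y' (i : 'I_(1 + m)) := match fintype.split i with inl _ => x | inr j => y j end.
  have My' : \matrix_i F (y' i) = col_mx (F x) M.
    apply/matrixP => i j; rewrite !mxE /y'.
    by case: (fintype.split i) => l; rewrite ?mxE.
  have : (\rank (col_mx (F x) M) <= k)%N.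
    by apply: kmax; apply/asboolP; exists (1 + m)%N, y'; rewrite My'.
  rewrite -yk => rk.
  have : (M <= col_mx (F x) M)%MS by rewrite -addsmxE addsmxSr.
  move/mxrank_leqif_sup => /leqifP; case: ifP.
    by move=> h _; apply: submx_trans h; rewrite -addsmxE addsmxSl.
  by move=> _; rewrite ltnNge rk.
have Mfull : row_full M.
  rewrite -cokermx_eq0; apply/eqP/matrixP => i j; rewrite [RHS]mxE.
  apply: (findep (fun i => cokermx M i j)) => x.
  have /eqP/matrixP/(_ 0 j) : F x *m cokermx M == 0 by rewrite -submxE.
  rewrite mxE [RHS]mxE => h; rewrite -[RHS]h.
  by apply: eq_bigr => l _; rewrite [F x _ _]mxE mulrC.
have ex i : exists x, F x = delta_mx 0 i.
  have /submxP[w hw] : ((delta_mx 0 i : 'rV[K]_n) <= M)%MS by apply: submx_full.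
  exists (\sum_l w 0 l *: y l); rewrite Fsum hw; apply/rowP => j.
  rewrite !mxE summxE; apply: eq_bigr => l _; by rewrite !mxE.
have [x xP] := choice ex; exists x => i j.
by have /rowP/(_ j) := xP i; rewrite !mxE eqxx eq_sym.
Qed.

Section Frames.
Variables (K : fieldType) (A : algType K).
Implicit Types (a u x y p q : A).

Definition semiprime := forall x, (forall y, x * y * x = 0) -> x = 0.

Definition minimal_idempotent p :=
  [/\ p != 0, p * p = p & forall x, exists l : K, p * x * p = l *: p].

(** The scalar l with p y p = l p; the default 0 is never used for a minimal
    idempotent p. *)
Definition corner p y : K := xget 0 [set l | p * y * p = l *: p].

Lemma cornerE p y : minimal_idempotent p -> p * y * p = corner p y *: p.
Proof.
move=> [_ _ /(_ y)[l hl]].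
by rewrite /corner; case: xgetP => [k -> //|/(_ l)].
Qed.

Lemma corner_unique p y l : minimal_idempotent p -> p * y * p = l *: p ->
  corner p y = l.
Proof.
move=> mp; rewrite cornerE// => /eqP; rewrite -subr_eq0 -scalerBl scaler_eq0.
by case: mp => /negPf -> _ _; rewrite orbF subr_eq0 => /eqP.
Qed.

Lemma corner_linear p : minimal_idempotent p -> linear (corner p : A -> K^o).
Proof.
move=> mp k x y; apply: corner_unique => //.
by rewrite mulrDr mulrDl -scalerAr -scalerAl !cornerE// scalerA -scalerDl.
Qed.

Lemma corner0 p : minimal_idempotent p -> corner p 0 = 0.
Proof. by move=> mp; apply: corner_unique; rewrite // mulr0 mul0r scale0r. Qed.

Lemma cornerD p x y : minimal_idempotent p ->
  corner p (x + y) = corner p x + corner p y.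
Proof. by move=> mp; have := corner_linear mp 1 x y; rewrite !scale1r. Qed.

Lemma cornerZ p k x : minimal_idempotent p -> corner p (k *: x) = k * corner p x.
Proof. by move=> mp; have := corner_linear mp k x 0; rewrite !addr0 corner0// addr0. Qed.

Lemma corner_sum p (I : Type) (r : seq I) (P : pred I) (F : I -> A) :
  minimal_idempotent p ->
  corner p (\sum_(i <- r | P i) F i) = \sum_(i <- r | P i) corner p (F i).
Proof.
by move=> mp; apply: (big_morph (corner p)) => [x y|]; [exact: cornerD|exact: corner0].
Qed.

Lemma corner_scale p k : minimal_idempotent p -> corner p (k *: p) = k.
Proof.
by move=> mp; apply: corner_unique => //; case: mp => _ pp _; rewrite -scalerAr -scalerAl !pp.
Qed.

Definition lin_indep n (e : 'I_n -> A) :=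
  forall t : 'I_n -> K, \sum_i t i *: e i = 0 -> forall i, t i = 0.

(** A factorization of [\sum_i c i * d i] through minimal idempotents. The last
    condition says that equivalent idempotents have been identified: p A q is a
    line for equivalent minimal idempotents p and q and is 0 otherwise. It makes
    [frame_mx] below block diagonal without any explicit blocks. *)
Definition frame n (p c d : 'I_n -> A) :=
  [/\ forall i, minimal_idempotent (p i), forall i, c i * p i = c i,
      forall i, p i * d i = d i
    & forall i j, p i = p j \/ forall x, p i * x * p j = 0].

Definition frame_mx n (p c d : 'I_n -> A) x : 'M[K]_n :=
  \matrix_(i, j) corner (p j) (d i * x * c j).

(** The bilinear combination of the c i and d j with coefficients N; together with
    [frame_mx] it lets products in the algebra be computed on matrices. *)
Definition frame_sum n (c d : 'I_n -> A) (N : 'M[K]_n) : A :=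
  \sum_i \sum_j N i j *: (c i * d j).

Section OneFrame.
Variables (n : nat) (p c d : 'I_n -> A).
Hypothesis Fr : frame p c d.
Local Notation M := (frame_mx p c d).
Local Notation S := (frame_sum c d).
Local Notation a := (\sum_i c i * d i).

Lemma frame_mxE x i j : d i * x * c j = M x i j *: p j.
Proof.
case: Fr => mp cp pd orth; rewrite mxE -cornerE//.
case: (orth i j) => [e|o]; first by rewrite -!mulrA cp !mulrA -e pd.
have -> : d i * x * c j = 0 by rewrite -pd -cp !mulrA -(mulrA (p i)) -(mulrA (p i)) o.
by rewrite mulr0 mul0r.
Qed.

(** When p i and p j differ the entry vanishes, and otherwise c i absorbs p j. *)
Lemma frame_mx_left x i j : M x i j *: (c i * p j) = M x i j *: c i.
Proof.
case: Fr => mp cp pd orth; case: (orth i j) => [e|o]; first by rewrite -e cp.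
have -> : M x i j = 0; last by rewrite !scale0r.
rewrite mxE; have -> : d i * x * c j = 0.
  by rewrite -pd -cp !mulrA -(mulrA (p i)) -(mulrA (p i)) o.
exact: corner0.
Qed.

Lemma frame_mx_linear k x y : M (k *: x + y) = k *: M x + M y.
Proof.
case: Fr => mp _ _ _; apply/matrixP => i j; rewrite !mxE.
by rewrite mulrDr mulrDl -scalerAr -scalerAl cornerD// cornerZ.
Qed.

Lemma frame_sum1 : S 1%:M = a.
Proof.
apply: eq_bigr => i _; rewrite (bigD1 i)//= !mxE eqxx scale1r big1 ?addr0// => j ji.
by rewrite !mxE eq_sym (negPf ji) scale0r.
Qed.

Lemma frame_sum0 : S 0 = 0.
Proof. by rewrite /frame_sum big1// => i _; rewrite big1// => j _; rewrite mxE scale0r. Qed.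

Lemma frame_sum_linear k N N' : S (k *: N + N') = k *: S N + S N'.
Proof.
rewrite scaler_sumr -big_split /=; apply: eq_bigr => i _.
rewrite scaler_sumr -big_split /=; apply: eq_bigr => j _.
by rewrite !mxE scalerA scalerDl.
Qed.

Lemma frame_mx_c x i j : c i * (d i * x * c j) = M x i j *: c i.
Proof. by rewrite frame_mxE -scalerAr frame_mx_left. Qed.

Lemma frame_mx_d x i j : d i * x * c j * d j = M x i j *: d j.
Proof. by case: Fr => _ _ pd _; rewrite frame_mxE -scalerAl pd. Qed.

Lemma frame_sum_mull x N : a * x * S N = S (M x *m N).
Proof.
rewrite !mulr_suml; apply: eq_bigr => i _; rewrite mulr_sumr.
transitivity (\sum_k \sum_j (M x i k * N k j) *: (c i * d j)).
  apply: eq_bigr => k _; rewrite mulr_sumr; apply: eq_bigr => j _.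
  have -> : M x i k * N k j = N k j * M x i k by rewrite mulrC.
  rewrite -scalerAr -scalerA; congr (_ *: _).
  by rewrite scalerAl -frame_mx_c !mulrA.
rewrite exchange_big; apply: eq_bigr => j _ /=; rewrite [in RHS]mxE scaler_suml//.
Qed.

Lemma frame_sum_mulr x N : S N * x * a = S (N *m M x).
Proof.
rewrite !mulr_suml; apply: eq_bigr => i _; rewrite !mulr_suml.
transitivity (\sum_k \sum_j (N i k * M x k j) *: (c i * d j)).
  apply: eq_bigr => k _; rewrite mulr_sumr; apply: eq_bigr => j _.
  rewrite -!scalerAl -scalerA; congr (_ *: _).
  by rewrite scalerAr -frame_mx_d !mulrA.
rewrite exchange_big; apply: eq_bigr => j _ /=; rewrite [in RHS]mxE scaler_suml//.
Qed.

(** Inserting a = sum_k c_k d_k between x and y is matrix multiplication. *)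
Lemma frame_mxM x y : M (x * a * y) = M x *m M y.
Proof.
case: Fr => mp cp pd orth.
apply/matrixP => i j; rewrite [LHS]mxE [RHS]mxE mulr_sumr mulr_suml mulr_sumr mulr_suml.
rewrite corner_sum//; apply: eq_bigr => k _.
rewrite -(corner_scale (_ * _) (mp j)); congr corner.
rewrite -scalerA -frame_mxE scalerAl scalerAl -frame_mx_d.
by rewrite !mulrA.
Qed.

(** Eigenvectors of the matrix become left eigenvectors of x a. *)
Lemma frame_row x (v : 'rV[K]_n) :
  (\sum_i v 0 i *: d i) * x * a = \sum_j (v *m M x) 0 j *: d j.
Proof.
rewrite !mulr_suml.
transitivity (\sum_i \sum_j (v 0 i * M x i j) *: d j).
  apply: eq_bigr => i _; rewrite mulr_sumr; apply: eq_bigr => j _.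
  by rewrite -!scalerAl mulrA frame_mx_d scalerA.
rewrite exchange_big; apply: eq_bigr => j _ /=; rewrite [in RHS]mxE scaler_suml//.
Qed.

Lemma frame_row_c x (v : 'rV[K]_n) j :
  (\sum_i v 0 i *: d i) * x * c j = (v *m M x) 0 j *: p j.
Proof.
rewrite !mulr_suml mxE scaler_suml; apply: eq_bigr => i _.
by rewrite -!scalerAl frame_mxE scalerA.
Qed.

End OneFrame.

End Frames.

(** * Independent frames *)

Section Reduction.
Variables (K : fieldType) (A : algType K).
Implicit Types (a u x y p q : A).

Lemma corner_swap n (p c d : 'I_n -> A) i j x : frame p c d ->
  corner (p i) (d i * x * c j) = corner (p j) (d i * x * c j).
Proof.
move=> Fr; case: (Fr) => mp cp pd orth; case: (orth i j) => [-> //|o].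
have -> : d i * x * c j = 0.
  by rewrite -pd -cp !mulrA -(mulrA (p i)) -(mulrA (p i)) o.
by rewrite !corner0.
Qed.

Lemma frame_trace n (p c d : 'I_n -> A) :
  \tr (frame_mx p c d 1) = \sum_i corner (p i) (d i * c i).
Proof. by apply: eq_bigr => i _; rewrite mxE mulr1. Qed.

Lemma lin_dep_solve n (e : 'I_n.+1 -> A) : ~ lin_indep e ->
  exists k (s : 'I_n -> K), e k = \sum_i s i *: e (lift k i).
Proof.
move=> /existsNP[t] /not_implyP[te] /existsNP[k /eqP tk].
exists k, (fun i => - (t k)^-1 * t (lift k i)).
move: te; rewrite (bigD1_ord k)//= => /eqP; rewrite addrC addr_eq0 => /eqP te.
under eq_bigr do rewrite -scalerA.
by rewrite -scaler_sumr te scalerN scaleNr opprK scalerA mulVf ?scale1r.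
Qed.

(** A dependent c k is a combination of the other c i, so that the term c k * d k
    can be redistributed over the other d i. The factor p (l i) in front of d k
    restores the frame condition, and c absorbs it. *)
Lemma frame_drop_c n (p c d : 'I_n.+1 -> A) : frame p c d -> ~ lin_indep c ->
  exists p' c' d' : 'I_n -> A,
  [/\ frame p' c' d', \sum_i c' i * d' i = \sum_i c i * d i &
    \tr (frame_mx p' c' d' 1) = \tr (frame_mx p c d 1)].
Proof.
move=> Fr /lin_dep_solve[k [s ck]]; case: (Fr) => mp cp pd orth.
pose l := lift k.
exists (p \o l), (c \o l), (fun i => d (l i) + s i *: (p (l i) * d k)).
split; first split => //= i.
- by rewrite mulrDr pd -scalerAr mulrA; case: (mp (l i)) => _ -> _.
- rewrite [RHS](bigD1_ord k)//= {1}ck mulr_suml addrC -big_split /=.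
  apply: eq_bigr => i _.
  by rewrite mulrDr -scalerAr mulrA cp -scalerAl.
rewrite !frame_trace [RHS](bigD1_ord k)//= {1}ck mulr_sumr corner_sum// addrC -big_split /=.
apply: eq_bigr => i _; rewrite mulrDl cornerD//; congr (_ + _).
rewrite -scalerAl -scalerAr !cornerZ//; congr (_ * _).
have := corner_swap k (l i) 1 Fr; rewrite mulr1 => ->.
apply: corner_unique => //; case: (mp (l i)) => _ pp _.
by rewrite !mulrA pp -[_ * d k * _]mulrA cornerE.
Qed.

(** The mirror image of [frame_drop_c]. *)
Lemma frame_drop_d n (p c d : 'I_n.+1 -> A) : frame p c d -> ~ lin_indep d ->
  exists p' c' d' : 'I_n -> A,
  [/\ frame p' c' d', \sum_i c' i * d' i = \sum_i c i * d i &
    \tr (frame_mx p' c' d' 1) = \tr (frame_mx p c d 1)].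
Proof.
move=> Fr /lin_dep_solve[k [s dk]]; case: (Fr) => mp cp pd orth.
pose l := lift k.
exists (p \o l), (fun i => c (l i) + s i *: (c k * p (l i))), (d \o l).
split; first split => //= i.
- by rewrite mulrDl cp -scalerAl -mulrA; case: (mp (l i)) => _ -> _.
- rewrite [RHS](bigD1_ord k)//= {1}dk mulr_sumr addrC -big_split /=.
  apply: eq_bigr => i _.
  by rewrite mulrDl -scalerAl -mulrA pd -scalerAr.
rewrite !frame_trace [RHS](bigD1_ord k)//= {1}dk mulr_suml corner_sum// addrC -big_split /=.
apply: eq_bigr => i _; rewrite mulrDr cornerD//; congr (_ + _).
rewrite -scalerAl -scalerAr !cornerZ//; congr (_ * _).
have := corner_swap (l i) k 1 Fr; rewrite mulr1 => <-.
apply: corner_unique => //; case: (mp (l i)) => _ pp _.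
by rewrite -!mulrA pp !mulrA -[_ * d (l i) * _]mulrA cornerE.
Qed.

Lemma frame_minimal n (p c d : 'I_n -> A) : frame p c d ->
  exists m (p' c' d' : 'I_m -> A),
  [/\ frame p' c' d', lin_indep c', lin_indep d',
   \sum_i c' i * d' i = \sum_i c i * d i &
    \tr (frame_mx p' c' d' 1) = \tr (frame_mx p c d 1)].
Proof.
elim: n => [|n IH] in p c d * => Fr.
  by exists 0%N, p, c, d; split => // t _ [].
have [ic|/(frame_drop_c Fr)[p' [c' [d' [Fr' <- <-]]]]] := pselect (lin_indep c);
  last exact: IH.
have [id|/(frame_drop_d Fr)[p' [c' [d' [Fr' <- <-]]]]] := pselect (lin_indep d);
  last exact: IH.
by exists n.+1, p, c, d.
Qed.

Hypothesis sA : semiprime A.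

(** By [linear_dual] it suffices that the scalars attached to the y c_j are
    independent forms in y. Applying a relation between them to p_l y isolates the
    terms with p_j = p_l: their combination e satisfies p_l A e = 0, hence
    e A e = 0 and e = 0. *)
Lemma frame_dual_c n (p c d : 'I_n -> A) : frame p c d -> lin_indep c ->
  exists y : 'I_n -> A, forall i j, y i * c j = (i == j)%:R *: p j.
Proof.
move=> [mp cp pd orth] ic.
have [|t ht l|y hy] := @linear_dual K A n (fun j y => corner (p j) (y * c j)).
- by move=> j k x y /=; rewrite mulrDl -scalerAl cornerD// cornerZ.
- pose e := \sum_(j | p j == p l) t j *: c j.
  have el : e * p l = e.
    by rewrite mulr_suml; apply: eq_bigr => j /eqP <-; rewrite -scalerAl cp.
  have pe x : p l * x * e = 0.
    rewrite mulr_sumr.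
    have := congr1 (fun k => k *: p l) (ht (p l * x)).
    rewrite scale0r scaler_suml => hs; rewrite -[RHS]hs [RHS](bigID (fun j => p j == p l)) /=.
    rewrite [X in _ = _ + X]big1 ?addr0; last first.
      move=> j jl; have -> : p l * x * c j = 0; last by rewrite corner0// mulr0 scale0r.
      by case: (orth l j) jl => [->|h _]; rewrite ?eqxx// -cp mulrA -(mulrA (p l)) h.
    apply: eq_bigr => j /eqP jl; rewrite -scalerAr -scalerA; congr (_ *: _).
    rewrite -jl -cornerE//; case: (mp j) => _ pp _.
    by rewrite !mulrA pp -[RHS]mulrA cp.
  have e0 : e = 0 by apply: sA => x; rewrite -{1}el -(mulrA e) -(mulrA e) pe mulr0.
  have := ic (fun j => if p j == p l then t j else 0).
  move=> /(_ _ l); rewrite eqxx; apply.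
  rewrite -[RHS]e0 [RHS]big_mkcond; apply: eq_bigr => j _.
  by case: ifP => // _; rewrite scale0r.
exists (fun i => p i * y i) => i j.
case: (orth i j) => [pij|o].
  by rewrite -hy -cornerE// pij -!mulrA cp.
rewrite -cp mulrA -(mulrA (p i)) o; case: eqVneq => [ij|]; last by rewrite scale0r.
by have := o 1; rewrite ij mulr1 scale1r; case: (mp j) => _ -> _.
Qed.

(** The mirror image of [frame_dual_c]. *)
Lemma frame_dual_d n (p c d : 'I_n -> A) : frame p c d -> lin_indep d ->
  exists z : 'I_n -> A, forall i j, d i * z j = (i == j)%:R *: p j.
Proof.
move=> [mp cp pd orth] ic.
have [|t ht l|z hz] := @linear_dual K A n (fun j z => corner (p j) (d j * z)).
- by move=> j k x y /=; rewrite mulrDr -scalerAr cornerD// cornerZ.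
- pose e := \sum_(j | p j == p l) t j *: d j.
  have el : p l * e = e.
    by rewrite mulr_sumr; apply: eq_bigr => j /eqP <-; rewrite -scalerAr pd.
  have pe x : e * x * p l = 0.
    rewrite !mulr_suml.
    have := congr1 (fun k => k *: p l) (ht (x * p l)).
    rewrite scale0r scaler_suml => hs; rewrite -[RHS]hs [RHS](bigID (fun j => p j == p l)) /=.
    rewrite [X in _ = _ + X]big1 ?addr0; last first.
      move=> j jl; have -> : d j * (x * p l) = 0; last by rewrite corner0// mulr0 scale0r.
      by case: (orth j l) jl => [->|h _]; rewrite ?eqxx// -pd !mulrA -(mulrA (p j)) h.
    apply: eq_bigr => j /eqP jl; rewrite -!scalerAl -scalerA; congr (_ *: _).
    rewrite -jl -cornerE//; case: (mp j) => _ pp _.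
    by rewrite -!mulrA pp !mulrA pd.
  have e0 : e = 0 by apply: sA => x; rewrite -{2}el mulrA pe mul0r.
  have := ic (fun j => if p j == p l then t j else 0).
  move=> /(_ _ l); rewrite eqxx; apply.
  rewrite -[RHS]e0 [RHS]big_mkcond; apply: eq_bigr => j _.
  by case: ifP => // _; rewrite scale0r.
exists (fun i => z i * p i) => i j.
case: (orth i j) => [pij|o].
  rewrite eq_sym -hz -pij -cornerE// -pd.
  by rewrite -!mulrA; case: (mp i) => _ pp _; rewrite !mulrA pp.
rewrite -pd !mulrA -(mulrA (p i)) o; case: eqVneq => [ij|]; last by rewrite scale0r.
by have := o 1; rewrite ij mulr1 scale1r; case: (mp j) => _ -> _.
Qed.

(** The case of diagonal matrices of the Jacobson density theorem: with dual families
    y of c and z of d, the element sum_l t_l z_l y_l does it. *)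
Lemma frame_mx_diag n (p c d : 'I_n -> A) (t : 'rV[K]_n) :
  frame p c d -> lin_indep c -> lin_indep d ->
  exists x, frame_mx p c d x = diag_mx t.
Proof.
move=> Fr ic id; have [y hy] := frame_dual_c Fr ic.
have [z hz] := frame_dual_d Fr id; case: (Fr) => mp _ _ _.
exists (\sum_l t 0 l *: (z l * y l)); apply/matrixP => i j; rewrite !mxE.
apply: corner_unique => //; rewrite mulr_sumr mulr_suml (bigD1 j)//= big1 => [|l lj].
  rewrite addr0 -scalerAr -scalerAl !mulrA hz -!mulrA [y _ * _]hy eqxx scale1r.
  case: (mp j) => _ pp _; rewrite -!scalerAl -!scalerAr !scalerA !mulrA !pp.
  by case: eqVneq => [->|_]; rewrite ?mulr1 ?mulr0 ?mulr1n ?mulr0n.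
by rewrite -scalerAr -scalerAl -!mulrA hy (negPf lj) scale0r !mulr0 scaler0.
Qed.

End Reduction.

(** * Existence of frames, polynomial calculus and spectrum *)

Section Existence.
Variables (K : fieldType) (A : algType K).
Implicit Types (a u x y p q : A).
Hypothesis sA : semiprime A.

Lemma semiprime_neq0 x : x != 0 -> exists y, x * y * x != 0.
Proof.
move=> /eqP x0; apply: contrapT => h; apply: x0; apply: sA => y.
by apply/eqP/negP => /negP xy; apply: h; exists y.
Qed.

(** Semiprimeness gives x with u x u nonzero, hence a multiple of u; rescaling x
    yields u x u = u. *)
Lemma minimal_idempotent_of_rank_one u : u != 0 ->
  (forall x, exists l : K, u * x * u = l *: u) ->
  exists x, minimal_idempotent (x * u) /\ u * (x * u) = u.
Proof.
move=> u0 ru; have [x ux] := semiprime_neq0 u0.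
have [l hl] := ru x; have l0 : l != 0.
  by apply: contraNneq ux => l0; rewrite hl l0 scale0r.
exists (l^-1 *: x); set x' := _ *: x.
have uxu : u * (x' * u) = u.
  by rewrite -scalerAl -scalerAr mulrA hl scalerA mulVf ?scale1r.
split=> //; split.
- by apply: contraNneq u0 => h; rewrite -uxu h mulr0.
- by rewrite -mulrA uxu.
move=> y; have [k hk] := ru (y * x'); exists k.
by rewrite -!mulrA in hk *; rewrite hk -scalerAr.
Qed.

(** If p A q is nonzero then q factors through p: the two idempotents are
    equivalent. *)
Lemma minimal_idempotent_factor p q w :
  minimal_idempotent p -> minimal_idempotent q -> p * w * q != 0 ->
  exists v, q = (q * v * p) * (p * w * q).
Proof.
move=> [_ pp _] [_ _ mq] /semiprime_neq0[y hy].
have [l hl] := mq (y * p * w).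
have l0 : l != 0.
  apply: contraNneq hy => l0.
  have -> : p * w * q * y * (p * w * q) = p * w * (q * (y * p * w) * q) by rewrite !mulrA.
  by rewrite hl l0 scale0r mulr0.
exists (l^-1 *: y); rewrite -[LHS]scale1r -(mulVf l0) -scalerA -hl.
rewrite -!scalerAr -!scalerAl; congr (_ *: _).
by rewrite -[in RHS](mulrA (q * y)) [p * (p * w * q)]mulrA (mulrA p p) pp !mulrA.
Qed.

(** Induction on the list: the minimal idempotent of a new element either factors
    through one already chosen, or is orthogonal to all of them on both sides and
    is added. *)
Lemma orthogonal_idempotents (s : seq A) :
  (forall u, u \in s -> u != 0 /\ forall x, exists l : K, u * x * u = l *: u) ->
  exists P : seq A, [/\ forall p, p \in P -> minimal_idempotent p,
    forall p q, p \in P -> q \in P -> p = q \/ forall x, p * x * q = 0 &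
    forall u, u \in s -> exists p c d, [/\ p \in P, u = c * d, c * p = c & p * d = d]].
Proof.
elim: s => [|u s IH] hs; first by exists [::].
have [P [mP oP sP]] : exists P : seq A, [/\ forall p, p \in P -> minimal_idempotent p,
    forall p q, p \in P -> q \in P -> p = q \/ forall x, p * x * q = 0 &
    forall u, u \in s -> exists p c d, [/\ p \in P, u = c * d, c * p = c & p * d = d]].
  by apply: IH => v vs; apply: hs; rewrite inE vs orbT.
have [u0 ru] := hs u (mem_head _ _).
have [x [mq uq]] := minimal_idempotent_of_rank_one u0 ru.
set q := x * u in mq uq.
have [[p pP [w pwq]]|hP] := pselect (exists2 p, p \in P & exists w, p * w * q != 0).
  exists P; split=> // v; rewrite inE => /predU1P[->|/sP//].
  have [t qE] := minimal_idempotent_factor (mP _ pP) mq pwq.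
  have [_ pp _] := mP _ pP.
  exists p, (u * (q * t * p)), (p * w * q); split=> //.
  - by rewrite -mulrA -qE.
  - by rewrite -!mulrA pp.
  - by rewrite !mulrA pp.
have o1 p w : p \in P -> p * w * q = 0.
  by move=> pP; apply: contrapT => /eqP h; apply: hP; exists p => //; exists w.
have o2 p w : p \in P -> q * w * p = 0.
  move=> pP; apply: sA => y.
  have -> : q * w * p * y * (q * w * p) = q * w * (p * y * q) * (w * p) by rewrite !mulrA.
  by rewrite o1// mulr0 mul0r.
exists (q :: P); split.
- by move=> p; rewrite inE => /predU1P[->|/mP].
- move=> p r; rewrite !inE => /predU1P[->|pP] /predU1P[->|rP]; try by left.
  + by right => w; apply: o2.
  + by right => w; apply: o1.
  + exact: oP.
move=> v; rewrite inE => /predU1P[->|/sP[p [c [d [pP e1 e2 e3]]]]].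
  exists q, u, q; case: mq => _ qq _; split=> //; exact: mem_head.
by exists p, c, d; split=> //; rewrite inE pP orbT.
Qed.

Lemma frame_exists (s : seq A) :
  (forall u, u \in s -> u != 0 /\ forall x, exists l : K, u * x * u = l *: u) ->
  exists p c d : 'I_(size s) -> A, frame p c d /\ \sum_i c i * d i = \sum_(u <- s) u.
Proof.
move=> /orthogonal_idempotents[P [mP oP sP]].
have : forall i : 'I_(size s), exists t : A * A * A,
   [/\ t.1.1 \in P, s`_i = t.1.2 * t.2, t.1.2 * t.1.1 = t.1.2 & t.1.1 * t.2 = t.2].
  move=> i; have [p [c [d h]]] := sP s`_i (mem_nth 0 (ltn_ord i)).
  by exists (p, c, d).
move=> /choice[t ht].
exists (fun i => (t i).1.1), (fun i => (t i).1.2), (fun i => (t i).2); split.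
  split=> [i|i|i|i j]; try by case: (ht i).
    by case: (ht i) => /mP.
  by case: (ht i) (ht j) => hi _ _ _ [hj _ _ _]; apply: oP.
rewrite (big_nth 0) big_mkord; apply: eq_bigr => i _.
by case: (ht i) => _ ->.
Qed.

End Existence.

Section Calculus.
Variables (K : fieldType) (A : algType K).
Variables (n : nat) (p c d : 'I_n.+1 -> A).
Hypothesis Fr : frame p c d.
Local Notation a := (\sum_i c i * d i).
Local Notation alpha := (frame_mx p c d 1).

Lemma frame_sum_horner (g : {poly K}) :
  horner_alg a g * a = frame_sum c d (horner_mx alpha g).
Proof.
elim/poly_ind: g => [|g k IH].
  by rewrite !rmorph0 mul0r frame_sum0.
rewrite !rmorphD !rmorphM /= !horner_algX !horner_algC horner_mx_X horner_mx_C.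
rewrite mulrDl.
 rewrite IH -[frame_sum _ _ _ in LHS]mulr1 (frame_sum_mulr Fr).
by rewrite -scalemx1 [in RHS]addrC frame_sum_linear frame_sum1 -scalerAl mul1r addrC.
Qed.

(** An element with a frame is algebraic. The extra factor X is there because the
    Cayley-Hamilton relation holds only on the span of the c i. *)
Lemma frame_annihilator : horner_alg a (char_poly alpha * 'X) = 0.
Proof.
rewrite rmorphM /= horner_algX frame_sum_horner Cayley_Hamilton.
exact: frame_sum0.
Qed.

(** If f = g X then f(a) = g(a) a has the frame g(a) c_i, d_i. A constant
    term would add a multiple of 1, which need not have a frame. *)
Lemma frame_horner (g : {poly K}) :
  let c' i := horner_alg a g * c i in
  [/\ frame p c' d, \sum_i c' i * d i = horner_alg a (g * 'X) &
    frame_mx p c' d 1 = horner_mx alpha (g * 'X)].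
Proof.
move=> c'; split.
- by case: Fr => mp cp pd o; split=> // i; rewrite /c' -mulrA cp.
- by rewrite rmorphM /= horner_algX mulr_sumr; apply: eq_bigr => i _; rewrite mulrA.
have -> : frame_mx p c' d 1 = frame_mx p c d (horner_alg a g).
  by apply/matrixP => i j; rewrite !mxE mulr1 /c' mulrA.
elim/poly_ind: g {c'} => [|g k IH].
  rewrite mul0r !rmorph0; apply/matrixP => i j; rewrite !mxE mulr0 mul0r corner0//.
  by case: Fr.
rewrite mulrDl !rmorphD !rmorphM /= !horner_algX !horner_algC !horner_mx_X !horner_mx_C.
rewrite addrC frame_mx_linear// -[_ * a]mulr1 frame_mxM// IH rmorphM /= horner_mx_X.
by rewrite addrC; congr (_ + _); rewrite -mulmxE mul_scalar_mx.
Qed.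

End Calculus.

Section Spectrum.
Variables (K : fieldType) (A : unitAlgType K).
Variables (n : nat) (p c d : 'I_n -> A).
Hypothesis Fr : frame p c d.
Local Notation a := (\sum_i c i * d i).
Local Notation M := (frame_mx p c d).

(** If l is not an eigenvalue of M(x), the inverse N of l - M(x) gives the inverse
    l^-1 (1 + sum_ij N_ij x c_i d_j) of l - x a. Conversely a row eigenvector v of
    M(x) gives w = sum_i v_i d_i with w x a = l w, and w is nonzero since
    w x c_j = l v_j p_j. *)
Lemma frame_spectrum x (l : K) : l != 0 ->
  (l%:A - x * a \isn't a GRing.unit) = root (char_poly (M x)) l.
Proof.
move=> l0; rewrite -eigenvalue_root_char.
apply/idP/idP; last first.
  move=> /eigenvalueP[v vM v0]; apply/negP => hu.
  pose w := \sum_i v 0 i *: d i.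
  have w0 : w * x * a = l *: w.
    rewrite (frame_row Fr) vM scaler_sumr; apply: eq_bigr => j _.
    by rewrite mxE scalerA.
  have : w * (l%:A - x * a) = 0.
    by rewrite mulrBr mulrA w0 -scalerAr mulr1 subrr.
  move=> /(congr1 (fun z => z * (l%:A - x * a)^-1)).
  rewrite mulrK// mul0r => wz; move/negP: v0; apply; apply/eqP/rowP => j.
  have := frame_row_c Fr x v j; rewrite -/w wz !mul0r vM !mxE => /esym/eqP.
  rewrite scaler_eq0 mulf_eq0 (negPf l0) /=.
  by case: Fr => /(_ j) [/negPf -> _ _] _ _ _; rewrite orbF => /eqP.
apply: contraR => nev.
have lM : l%:M - M x \in unitmx.
  rewrite unitmxE unitfE; apply: contra nev => /det0P[v v0].
  rewrite mulmxBr mul_mx_scalar => /eqP; rewrite subr_eq0 => /eqP h.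
  by apply/eigenvalueP; exists v.
set N := invmx (l%:M - M x).
have N1 : M x *m N = l *: N - 1%:M.
  by have := mulmxV lM; rewrite -/N mulmxBl mul_scalar_mx => <-; rewrite subKr.
have N2 : N *m M x = l *: N - 1%:M.
  by have := mulVmx lM; rewrite -/N mulmxBr mul_mx_scalar => <-; rewrite subKr.
pose R := frame_sum c d N.
have SB : frame_sum c d (l *: N - 1%:M) = l *: R - a.
  rewrite -scaleN1r addrC frame_sum_linear frame_sum1 -[l *: N]addr0.
  by rewrite frame_sum_linear frame_sum0 addr0 scaleN1r addrC.
have R1 : x * a * (x * R) = l *: (x * R) - x * a.
  by rewrite -mulrA [a * _]mulrA (frame_sum_mull Fr) N1 SB mulrBr -scalerAr.
have R2 : (x * R) * (x * a) = l *: (x * R) - x * a.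
  by rewrite -mulrA [R * _]mulrA (frame_sum_mulr Fr) N2 SB mulrBr -scalerAr.
have e1 : (1 + x * R) * (l%:A - x * a) = l%:A.
  by rewrite mulrDl mul1r mulrBr R2 -scalerAr mulr1 subKr subrK.
have e2 : (l%:A - x * a) * (1 + x * R) = l%:A.
  by rewrite mulrDr mulr1 mulrBl R1 -scalerAl mul1r subKr subrK.
apply/unitrP; exists (l^-1 *: (1 + x * R)).
by rewrite -scalerAl -scalerAr e1 e2 scalerA mulVf// scale1r.
Qed.

Lemma frame_unit_mx : a \is a GRing.unit -> lin_indep d -> M 1 \in unitmx.
Proof.
move=> au id; rewrite unitmxE unitfE; apply/negP => /det0P[v v0 vM].
have := frame_row Fr 1 v; rewrite vM mulr1.
rewrite [RHS]big1 => [|j _]; last by rewrite mxE scale0r.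
move=> /(congr1 (fun z => z * a^-1)); rewrite mulrK// mul0r => /id h.
by move/eqP: v0; apply; apply/rowP => j; rewrite h mxE.
Qed.

(** If a and M(x) are invertible, then sum_ij (M(x)^-1)_ij c_i d_j is the inverse
    of x. *)
Lemma frame_unit x : a \is a GRing.unit -> M x \in unitmx -> x \is a GRing.unit.
Proof.
move=> au xu; apply/unitrP; exists (frame_sum c d (invmx (M x))).
have e1 := frame_sum_mull Fr x (invmx (M x)).
have e2 := frame_sum_mulr Fr x (invmx (M x)).
rewrite mulmxV// frame_sum1 in e1; rewrite mulVmx// frame_sum1 in e2.
split; first by rewrite -[LHS](mulrK au) e2 mulrV.
by rewrite -[LHS](mulKr au) [a * _]mulrA e1 mulVr.
Qed.

End Spectrum.

(** * Superexponential decay and nilpotency *)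

Section Quasinilpotent.
Variables (K : numFieldType) (A : banachAlgType K) (a b : A).
Local Notation T := (fun x : A => a * x - x * b).

(** Decay of the powers of T at v faster than every geometric sequence. The constant
    C makes the condition stable under multiplication of v by a fixed element. *)
Definition superexponential (v : A) := forall e C : K, 0 < e -> 0 < C ->
  \forall m \near \oo, `|iter m T v| <= C * e ^+ m.

Lemma iter_comm_linear m k (x y : A) : iter m T (k *: x + y) = k *: iter m T x + iter m T y.
Proof.
elim: m => // m IH; rewrite !iterS IH mulrDr mulrDl -scalerAr -scalerAl.
by rewrite scalerBr opprD addrACA.
Qed.

Lemma iter_comm0 m : iter m T 0 = 0.
Proof. by have := iter_comm_linear m (-1) 0 0; rewrite scaler0 addr0 scaleN1r addNr. Qed.

Lemma iter_comm_mull m (z v : A) : GRing.comm a z -> iter m T (z * v) = z * iter m T v.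
Proof.
by move=> az; elim: m => // m IH; rewrite !iterS IH mulrBr !mulrA az.
Qed.

Lemma iter_comm_mulr m (z v : A) : GRing.comm b z -> iter m T (v * z) = iter m T v * z.
Proof.
by move=> bz; elim: m => // m IH; rewrite !iterS IH mulrBl -!mulrA -bz.
Qed.

Lemma superexponential_mull (z v : A) : GRing.comm a z ->
  superexponential v -> superexponential (z * v).
Proof.
move=> az qv e C e0 C0; have z0 : 0 < `|z| + 1 by rewrite ltr_wpDl.
apply: filterS (qv e (C / (`|z| + 1)) e0 (divr_gt0 C0 z0)) => m hm.
rewrite iter_comm_mull// (le_trans (ler_normBM _ _))//.
apply: (@le_trans _ _ ((`|z| + 1) * `|iter m T v|)).
  by rewrite ler_wpM2r// lerDl.
by rewrite mulrC -ler_pdivlMr// mulrAC.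
Qed.

Lemma superexponential_mulr (z v : A) : GRing.comm b z ->
  superexponential v -> superexponential (v * z).
Proof.
move=> bz qv e C e0 C0; have z0 : 0 < `|z| + 1 by rewrite ltr_wpDl.
apply: filterS (qv e (C / (`|z| + 1)) e0 (divr_gt0 C0 z0)) => m hm.
rewrite iter_comm_mulr// (le_trans (ler_normBM _ _))//.
apply: (@le_trans _ _ (`|iter m T v| * (`|z| + 1))).
  by rewrite ler_wpM2l// lerDl.
by rewrite -ler_pdivlMr// mulrAC.
Qed.

Lemma superexponential_iter k (v : A) : superexponential v -> superexponential (iter k T v).
Proof.
move=> qv e C e0 C0.
have [m0 _ hm0] := qv e (C / e ^+ k) e0 (divr_gt0 C0 (exprn_gt0 k e0)).
exists m0 => // m hm; rewrite /= -iterD addnC.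
have := hm0 (k + m)%N; rewrite /= => /(_ (leq_trans hm (leq_addl _ _))).
by rewrite exprD mulrA divfK// expf_neq0// gt_eqF.
Qed.

(** The powers of T on w are r^m w, which violates the decay at rate |r| unless r or
    w vanishes. *)
Lemma superexponential_eigen (w : A) (r : K) : superexponential w -> T w = r *: w -> T w = 0.
Proof.
move=> qw wr; have iw m : iter m T w = r ^+ m *: w.
  elim: m => [|m IH]; first by rewrite scale1r.
  by rewrite iterS IH -scalerAr -scalerAl -scalerBr wr scalerA exprSr.
have [r0|r0] := eqVneq r 0; first by rewrite wr r0 scale0r.
have [w0|w0] := eqVneq w 0; first by rewrite w0 mulr0 mul0r subrr.
have nr : 0 < `|r| by rewrite normr_gt0.
have nw : 0 < `|w| by rewrite normr_gt0.
have [m _ /(_ m (leqnn m)) /=] := qw `|r| (`|w| / 2) nr (divr_gt0 nw (ltr0Sn K 1)).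
rewrite iw normrZ normrX mulrC ler_pM2r ?exprn_gt0//.
by rewrite ler_pdivlMr// mulr_natr mulr2n gerDl (lt_geF nw).
Qed.

(** Induction on the number of factors. For roots l of the first and m of the second
    polynomial, the vectors (a - l) v and v (b - m) lose a factor, so T^(N-1)
    kills both. Their difference is T v - (l - m) v, so T^(N-1) v is an eigenvector
    of T, and [superexponential_eigen] applies to it. *)
Lemma superexponential_nilpotent ls ms (v : A) :
  horner_alg a (\prod_(l <- ls) ('X - l%:P)) * v = 0 ->
  v * horner_alg b (\prod_(m <- ms) ('X - m%:P)) = 0 ->
  superexponential v -> iter (size ls + size ms) T v = 0.
Proof.
have [n] := ubnP (size ls + size ms).
elim: n => // n IH in ls ms v *; rewrite ltnS => hn hl hm qv.
case: ls => [|l ls] in hn hl *.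
  by rewrite big_nil rmorph1 mul1r in hl; rewrite hl iter_comm0.
case: ms => [|m ms] in hn hm *.
  by rewrite big_nil rmorph1 mulr1 in hm; rewrite hm iter_comm0.
have comm_a g : GRing.comm a (horner_alg a g).
  by rewrite /GRing.comm -{1 4}[a](horner_algX a) -!rmorphM /= mulrC.
have comm_b g : GRing.comm b (horner_alg b g).
  by rewrite /GRing.comm -{1 4}[b](horner_algX b) -!rmorphM /= mulrC.
set N := (size ls + size ms).+1.
have h1 : iter N T (horner_alg a ('X - l%:P) * v) = 0.
  have := IH ls (m :: ms) (horner_alg a ('X - l%:P) * v).
  rewrite /= addnS; apply.
  - by rewrite (leq_trans _ hn)//= addSn addnS.
  - by move: hl; rewrite big_cons mulrC rmorphM /= mulrA.
  - by rewrite -mulrA hm mulr0.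
  - exact: superexponential_mull.
have h2 : iter N T (v * horner_alg b ('X - m%:P)) = 0.
  have := IH (l :: ls) ms (v * horner_alg b ('X - m%:P)).
  rewrite /= addSn; apply.
  - by rewrite (leq_trans _ hn)//= addSn addnS.
  - by rewrite mulrA hl mul0r.
  - by move: hm; rewrite big_cons rmorphM /= mulrA.
  - exact: superexponential_mulr.
rewrite /= addnS -/N; set w := iter N T v.
apply: (@superexponential_eigen w (l - m)); first exact: superexponential_iter.
move: h1 h2; rewrite (iter_comm_mull N _ (comm_a _)) (iter_comm_mulr N _ (comm_b _)).
rewrite -/w !rmorphB /= !horner_algX !horner_algC.
rewrite mulrBl mulr_algl [w * _]mulrBr mulr_algr.
by move=> /eqP; rewrite subr_eq0 => /eqP -> /eqP; rewrite subr_eq0 => /eqP ->; rewrite scalerBl.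
Qed.

(** Take f equal to r to high order at every r in rs. The higher derivatives of f are
    then divisible by the polynomial that annihilates b, and only the first term
    f(b) of the Taylor expansion of f(a) survives. *)
Lemma superexponential_common_calculus ls ms rs : uniq rs ->
  {subset ms <= rs} ->
  horner_alg a (\prod_(l <- ls) ('X - l%:P)) = 0 ->
  horner_alg b (\prod_(m <- ms) ('X - m%:P)) = 0 ->
  superexponential 1 ->
  exists2 f : {poly K}, horner_alg a f = horner_alg b f &
    forall r, r \in rs -> 'X - r%:P %| f - r%:P.
Proof.
move=> urs srs ha hb q1.
pose N := (size ls + size ms)%N.
have TN : iter N.+1 T 1 = 0.
  by rewrite iterS superexponential_nilpotent ?mulr0 ?mul0r ?subrr// ?ha ?hb ?mulr0 ?mul0r.
have [f hf] := @hermite_interpolation K rs (size ms + N).+1 urs.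
exists f; last by move=> r /hf; apply: dvdp_trans; rewrite exprS dvdp_mulr.
rewrite (noncommutative_taylor f TN) big_ord_recl /= nderivn0 mul1r big1 ?addr0// => k _.
suff /dvdpP[g ->] : \prod_(m <- ms) ('X - m%:P) %| f^`N(k.+1).
  by rewrite rmorphM /= hb !mulr0.
apply: dvdp_prod_XsubC_pow => m mms.
have -> : f^`N(k.+1) = (f - m%:P)^`N(k.+1) by rewrite nderivnB nderivnC subr0.
apply: dvdp_nderivn; apply: dvdp_trans (hf m (srs _ mms)).
by apply: dvdp_exp2l; rewrite (leq_trans _ (leqnSn _))// leq_add2l ltn_ord.
Qed.

End Quasinilpotent.

(** * Continuity of characteristic polynomials *)

Section PolyContinuity.
Variables (K : numFieldType) (X : topologicalType) (x0 : X).

Lemma cvg_finite_sum (I : Type) (r : seq I) (f : I -> X -> K) (l : I -> K) :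
  (forall i, f i x @[x --> x0] --> l i) ->
  \sum_(i <- r) f i x @[x --> x0] --> \sum_(i <- r) l i.
Proof.
move=> fl; elim: r => [|i r IH].
  by rewrite big_nil; under eq_fun do rewrite big_nil; apply: cvg_cst.
by rewrite big_cons; under eq_fun do rewrite big_cons; apply: cvgD.
Qed.

(** Coefficientwise continuity suffices for families of polynomials of bounded
    degree, and needs no topology on the polynomial ring. *)
Definition coef_continuous (F : X -> {poly K}) :=
  forall k, (F x)`_k @[x --> x0] --> (F x0)`_k.

Lemma coef_continuous_cst q : coef_continuous (fun=> q).
Proof. by move=> k; apply: cvg_cst. Qed.

Lemma coef_continuousC (f : X -> K) :
  f x @[x --> x0] --> f x0 -> coef_continuous (fun x => (f x)%:P).
Proof.
move=> fc k; rewrite coefC; under eq_fun do rewrite coefC.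
by case: (k == 0%N) => //; apply: cvg_cst.
Qed.

Lemma coef_continuousD F G : coef_continuous F -> coef_continuous G ->
  coef_continuous (fun x => F x + G x).
Proof.
move=> Fc Gc k; rewrite coefD; under eq_fun do rewrite coefD.
exact: cvgD.
Qed.

Lemma coef_continuousM F G : coef_continuous F -> coef_continuous G ->
  coef_continuous (fun x => F x * G x).
Proof.
move=> Fc Gc k; rewrite coefM; under eq_fun do rewrite coefM.
by apply: cvg_finite_sum => i; apply: cvgM.
Qed.

Lemma coef_continuous_sum (I : Type) (r : seq I) (F : I -> X -> {poly K}) :
  (forall i, coef_continuous (F i)) ->
  coef_continuous (fun x => \sum_(i <- r) F i x).
Proof.
move=> Fc; elim: r => [|i r IH].
  by under eq_fun do rewrite big_nil; apply: coef_continuous_cst.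
by under eq_fun do rewrite big_cons; apply: coef_continuousD.
Qed.

Lemma coef_continuous_prod (I : Type) (r : seq I) (F : I -> X -> {poly K}) :
  (forall i, coef_continuous (F i)) ->
  coef_continuous (fun x => \prod_(i <- r) F i x).
Proof.
move=> Fc; elim: r => [|i r IH].
  by under eq_fun do rewrite big_nil; apply: coef_continuous_cst.
by under eq_fun do rewrite big_cons; apply: coef_continuousM.
Qed.

Lemma coef_continuous_char_poly n (M : X -> 'M[K]_n) :
  (forall i j, M x i j @[x --> x0] --> M x0 i j) ->
  coef_continuous (fun x => char_poly (M x)).
Proof.
move=> Mc; apply: coef_continuous_sum => s.
apply: coef_continuousM; first exact: coef_continuous_cst.
apply: coef_continuous_prod => i; under eq_fun do rewrite !mxE.
apply: coef_continuousD; first exact: coef_continuous_cst.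
under eq_fun do rewrite -polyCN; apply: coef_continuousC.
exact: cvgN.
Qed.

(** Roots counted with multiplicity move continuously, and none of them sits on the
    boundary of the disk. *)
Lemma roots_count_near n (M : X -> 'M[K]_n) (zs : seq K) (l r : K) :
  (forall i j, M x i j @[x --> x0] --> M x0 i j) ->
  char_poly (M x0) = \prod_(z <- zs) ('X - z%:P) ->
  0 < r -> (forall z, z \in zs -> z != l -> r < `|l - z|) ->
  \forall x \near x0, forall ws, char_poly (M x) = \prod_(w <- ws) ('X - w%:P) ->
    count (fun w => `|l - w| < r) ws = count_mem l zs.
Proof.
move=> Mc zsE r0 isol.
(* Within distance e of its limit, a root stays on its side of the circle. *)
have [e [e0 er eg]] : exists e : K, [/\ 0 < e, e <= r &
    forall z, z \in zs -> z != l -> e <= `|l - z| - r].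
  elim: zs isol {zsE} => [|z zs IH] isol; first by exists r.
  have [|e [e0 er eg]] := IH; first by move=> y yzs; apply: isol; rewrite inE yzs orbT.
  have [zl|zl] := eqVneq z l.
    exists e; split=> // y; rewrite inE => /predU1P[->|]; first by rewrite zl eqxx.
    exact: eg.
  have h : 0 < `|l - z| - r by rewrite subr_gt0 isol ?mem_head.
  have [e' [e'0 e'e e'h]] := exists_pos_le2 e0 h.
  exists e'; split=> //; first exact: le_trans er.
  move=> y; rewrite inE => /predU1P[-> //|yzs yl].
  exact: le_trans (eg _ yzs yl).
have [d d0 Hd] := roots_continuity zs e0.
have coefc := coef_continuous_char_poly Mc.
have : \forall x \near x0, forall k : 'I_n.+1,
    `|(char_poly (M x0))`_k - (char_poly (M x))`_k| <= d.
  by apply: filter_forall => k; move/cvgrPdist_le : (coefc k); apply.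
apply: filterS => x hx ws wsE.
have szs : size zs = n.
  by apply/eqP; rewrite -eqSS -(size_prod_XsubC _ id) -zsE size_char_poly.
have sws : size ws = n.
  by apply/eqP; rewrite -eqSS -(size_prod_XsubC _ id) -wsE size_char_poly.
have [||ws' /permP -> ] := Hd ws; first by rewrite sws.
  move=> k; rewrite -zsE -wsE coefB; have [kn|nk] := ltnP k n.+1.
    exact: (hx (Ordinal kn)).
  by rewrite !nth_default ?size_char_poly// subrr normr0 ltW.
elim: zs ws' {isol zsE Hd szs} eg => [|z zs IH] [|w ws'] //= eg /andP[zw zws].
rewrite IH// => [|y yzs]; last by apply: eg; rewrite inE yzs orbT.
congr (_ + _)%N; congr nat_of_bool; case: eqVneq => [zl|zl].
  by rewrite -zl (lt_le_trans zw).
have /(_ zl) h := eg z (mem_head _ _).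
apply/negP => lw.
have lz : `|l - w| + `|w - z| < `|l - z|.
  apply: (@lt_le_trans _ _ (r + e)); last by rewrite addrC -lerBrDr.
  by rewrite ltrD// distrC.
by have := le_lt_trans (ler_distD w l z) lz; rewrite ltxx.
Qed.

End PolyContinuity.

(** * Norm estimates and semiprimeness *)

Section CornerNorm.
Variables (K : numFieldType) (A : banachAlgType K).

Lemma ler_norm_corner (p y : A) : minimal_idempotent p ->
  `|corner p y| <= `|p| * `|y|.
Proof.
move=> mp; have p0 : 0 < `|p| by rewrite normr_gt0; case: mp.
rewrite -(ler_pM2r p0) -normrZ -cornerE//.
rewrite (le_trans (ler_normBM _ _))// ler_wpM2r//; exact: ler_normBM.
Qed.

Lemma frame_mx_cvg n (p c d : 'I_n -> A) i j (x0 : A) : frame p c d ->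
  frame_mx p c d x i j @[x --> x0] --> frame_mx p c d x0 i j.
Proof.
move=> Fr; case: (Fr) => mp _ _ _.
apply/cvgrPdist_le => e e0.
pose C := `|p j| * (`|d i| * `|c j|) + 1.
have C0 : 0 < C by rewrite ltr_wpDl// !mulr_ge0.
near=> x; have -> : frame_mx p c d x0 i j - frame_mx p c d x i j =
    corner (p j) (d i * (x0 - x) * c j).
  by rewrite !mxE mulrBr mulrBl cornerD// -[- (d i * x * c j)]scaleN1r cornerZ// mulN1r.
apply: (le_trans (ler_norm_corner _ (mp j))).
apply: (@le_trans _ _ (C * `|x0 - x|)).
  apply: (@le_trans _ _ (`|p j| * (`|d i| * `|c j|) * `|x0 - x|)); last first.
    by rewrite ler_wpM2r// lerDl.
  rewrite -[leRHS]mulrA ler_wpM2l// (le_trans (ler_normBM _ _))// mulrAC ler_wpM2r//.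
  exact: ler_normBM.
rewrite mulrC -ler_pdivlMr//.
near: x; apply: (@cvgr_dist_le _ _ _ _ _ id x0 cvg_id).
by rewrite divr_gt0.
Unshelve. all: by end_near. Qed.

End CornerNorm.

Section Rho.
Variables (R : realType) (A : banachAlgType R[i]) (a b : A).

(** An upper limit 0 bounds the m-th root of the norm by e / 2 for large m, and the
    factor 2^-m absorbs the constant C. *)
Lemma rho_superexponential : rho a b = 0%E -> superexponential a b (1 : A).
Proof.
move=> rab e C e0 C0.
have eE := RRe_real (gtr0_real e0); have CE := RRe_real (gtr0_real C0).
move: (complex.Re e) (complex.Re C) eE CE => e' C' eE CE.
rewrite -eE ltcR in e0; rewrite -CE ltcR in C0.
have inf0 : ereal_inf (range (esups (fun n : nat =>
    (complex.Re `|iter n (comm_op a b) 1| `^ n%:R^-1)%:E))) = 0%E.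
  by rewrite -rab /rho limn_esup_lim; apply/esym/cvg_lim => //; apply: cvg_esups_inf.
have e20 : 0 < e' / 2 by rewrite divr_gt0.
have : (ereal_inf (range (esups (fun n : nat =>
    (complex.Re `|iter n (comm_op a b) 1| `^ n%:R^-1)%:E))) < (e' / 2)%:E)%E.
  by rewrite inf0 lte_fin.
move=> /ereal_inf_lt[_ [n _ <-] hn].
have half : \forall m \near \oo, (2^-1 : R) ^+ m <= C'.
  have /cvgrPdist_le/(_ C' C0) : (GRing.exp (2^-1 : R) : R ^nat) @ \oo --> (0 : R).
    by apply: cvg_expr; rewrite ger0_norm ?invr_ge0// invf_lt1// ltr1n.
  apply: filterS => m; rewrite sub0r normrN ger0_norm// exprn_ge0// invr_ge0//.
near=> m.
have nE := RRe_real (normr_real (iter m (comm_op a b) (1 : A))).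
rewrite -[iter _ _ _]/(iter m (comm_op a b) 1) -nE -eE -CE -rmorphXn -rmorphM /= lecR.
set t := complex.Re _.
have t0 : 0 <= t.
  by rewrite -lecR nE; exact: normr_ge0.
have m0 : (0 < m)%N by near: m; exists 1%N.
have tm : t `^ m%:R^-1 <= e' / 2.
  rewrite -lee_fin (le_trans _ (ltW hn))//.
  apply: ereal_sup_ubound; exists m => //=.
  by near: m; exists n.
have -> : t = (t `^ m%:R^-1) ^+ m.
  by rewrite -powR_mulrn ?powR_ge0// -powRrM mulVf ?powRr1// pnatr_eq0 -lt0n.
apply: (@le_trans _ _ ((e' / 2) ^+ m)).
  by rewrite lerXn2r// nnegrE ?powR_ge0// ltW.
rewrite exprMn mulrC; apply: ler_wpM2r; first by rewrite exprn_ge0 ?ltW.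
by near: m.
Unshelve. all: by end_near. Qed.
End Rho.

(** If x A x = 0 and a maximal left ideal M misses x, then M + A x = A, say
    1 = m + z x; multiplying by x on the left gives x = x m, an element of M. *)
Lemma semisimple_semiprime (R : realType) (A : banachAlgType R[i]) :
  semisimple A -> semiprime A.
Proof.
move=> sA x xAx.
suff : [set 0 : A] x by [].
rewrite -sA => M [[M0 MD MM] MT mM]; apply: contrapT => xM.
pose I := [set y : A | exists m z, M m /\ y = m + z * x].
have [||IM|IT] := mM I.
- split.
  + by exists 0, 0; rewrite mul0r addr0.
  + move=> _ _ [m [z [Mm ->]]] [m' [z' [Mm' ->]]].
    by exists (m + m'), (z + z'); split; [exact: MD | rewrite mulrDl addrACA].
  + move=> w _ [m [z [Mm ->]]]; exists (w * m), (w * z); split; first exact: MM.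
    by rewrite mulrDr mulrA.
- by move=> m Mm; exists m, 0; rewrite mul0r addr0.
- by apply: xM; rewrite -IM; exists 0, 1; rewrite mul1r add0r.
have : I 1 by rewrite IT.
move=> [m [z [Mm h]]]; apply: xM.
rewrite -[x]mulr1 h mulrDr mulrA xAx addr0; exact: MM.
Qed.

(** * The spectral trace is a matrix trace *)

Lemma counting_seq (T : choiceType) (R : realType) (s : seq T) : uniq s ->
  counting [set` s] = (size s)%:R%:E :> \bar R.
Proof.
move=> us; rewrite /counting; case: asboolP => [_|]; last by case; exact: finite_seq.
have -> : [set` s] = [set` [fset x in s]%fset].
  by apply/seteqP; split=> x /=; rewrite inE.
by rewrite set_fsetK card_fseq undup_id.
Qed.

Lemma size_filter_undup (T : eqType) (x0 : T) (s : seq T) :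
  (size [seq x <- undup s | x != x0] == size s) = uniq (x0 :: s).
Proof.
rewrite size_filter; apply/eqP/idP => [h|/= /andP[x0s us]].
  have h1 : (size s <= size (undup s))%N by rewrite -[leqLHS]h count_size.
  have us : uniq s by rewrite -[uniq s]negbK -ltn_size_undup -leqNgt.
  rewrite /= us andbT; apply/negP => x0s; move: h; rewrite undup_id//.
  move/eqP; rewrite -all_count => /allP /(_ _ x0s); rewrite eqxx//.
rewrite undup_id//; apply/eqP; rewrite -all_count; apply/allP => x xs.
by apply: contraNneq x0s => <-.
Qed.

(** Points at distance r are limits of points of the segment towards the center. *)
Lemma closure_ball_le (K : numFieldType) (l z r : K) : 0 < r -> `|l - z| <= r ->
  closure (ball (l : K^o) r) z.
Proof.
move=> r0 lz B /nbhs_ballP[e /= e0 eB].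
pose t := e / (e + r); have er : 0 < e + r by rewrite addr_gt0.
have t0 : 0 < t by rewrite divr_gt0.
have t1 : t < 1 by rewrite ltr_pdivrMr// mul1r ltrDl.
exists (z + t * (l - z)); split.
  rewrite -ball_normE /=.
  have -> : l - (z + t * (l - z)) = (1 - t) * (l - z) by ring.
  rewrite normrM ger0_norm ?subr_ge0 ?ltW//.
  apply: (@le_lt_trans _ _ ((1 - t) * r)); first by rewrite ler_wpM2l// subr_ge0 ltW.
  by rewrite gtr_pMl// gtrBl.
apply: eB; rewrite -ball_normE /=.
have -> : z - (z + t * (l - z)) = - (t * (l - z)) by ring.
rewrite normrN normrM gtr0_norm//.
apply: (@le_lt_trans _ _ (t * r)); first by rewrite ler_wpM2l// ltW.
by rewrite /t mulrAC ltr_pdivrMr// ltr_pM2l// ltrDr.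
Qed.

Lemma closure_ball_ge (K : numFieldType) (l z r : K) :
  closure (ball (l : K^o) r) z -> ~ r < `|l - z|.
Proof.
move=> clz lz; have h : 0 < `|l - z| - r by rewrite subr_gt0.
have [y []] := clz _ (nbhsx_ballx (z : K^o) _ h).
rewrite -!ball_normE /= => ly; rewrite distrC => yz.
have := le_lt_trans (ler_distD y l z) (ltrD ly yz).
by rewrite [ltRHS]addrC subrK ltxx.
Qed.

Lemma root0_char_poly (K : fieldType) n (N : 'M[K]_n) :
  root (char_poly N) 0 = (N \notin unitmx).
Proof.
by rewrite /root horner_coef0 char_poly_det mulf_eq0 signr_eq0 unitmxE unitfE negbK.
Qed.

Section MinimalFrame.
Variables (R : realType) (A : banachAlgType R[i]).
Variables (n : nat) (p c d : 'I_n -> A).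
Hypothesis sA : semiprime A.
Hypothesis Fr : frame p c d.
Hypothesis ci : lin_indep c.
Hypothesis di : lin_indep d.
Local Notation K := R[i].
Local Notation a := (\sum_i c i * d i).
Local Notation M := (frame_mx p c d).

Lemma spectrum'E x ws : char_poly (M x) = \prod_(w <- ws) ('X - w%:P) ->
  spectrum' (x * a) = [set` [seq w <- undup ws | w != 0]].
Proof.
move=> wsE; apply/seteqP; split=> l.
  move=> [/= sl /eqP l0]; rewrite mem_filter l0 mem_undup /=.
  by move: sl; rewrite /spectrum /= (frame_spectrum Fr)// wsE root_prod_XsubC.
rewrite /= mem_filter mem_undup => /andP[l0 lws]; split; last exact/eqP.
by rewrite /spectrum /= (frame_spectrum Fr)// wsE root_prod_XsubC.
Qed.

Lemma counting_spectrum' x ws : char_poly (M x) = \prod_(w <- ws) ('X - w%:P) ->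
  counting (spectrum' (x * a)) = (size [seq w <- undup ws | w != 0])%:R%:E :> \bar R.
Proof. by move=> /spectrum'E ->; rewrite counting_seq ?filter_uniq ?undup_uniq. Qed.

Lemma exists_generic : exists x ws,
  char_poly (M x) = \prod_(w <- ws) ('X - w%:P) /\ uniq (0 :: ws).
Proof.
have [x xE] := frame_mx_diag sA (\row_i (i.+1%:R : K)) Fr ci di.
exists x, [seq (i.+1%:R : K) | i <- iota 0 n]; split.
  rewrite xE char_poly_trig ?diag_mx_is_trig// big_map.
  have -> : iota 0 n = index_iota 0 n by rewrite /index_iota subn0.
  by rewrite big_mkord; apply: eq_bigr => i _; rewrite !mxE eqxx.
rewrite /= map_inj_uniq ?iota_uniq ?andbT.
  by apply/mapP => -[k _ /esym/eqP]; rewrite pnatr_eq0.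
by move=> k l /eqP; rewrite eqr_nat => /eqP[].
Qed.

Lemma size_char_roots x ws : char_poly (M x) = \prod_(w <- ws) ('X - w%:P) ->
  size ws = n.
Proof.
by move=> wsE; apply/eqP; rewrite -eqSS -(size_prod_XsubC _ id) -wsE size_char_poly.
Qed.

Lemma rank_frame : rank a = n%:R%:E.
Proof.
apply/eqP; rewrite eq_le; apply/andP; split.
  apply: ge_ereal_sup => _ [x _ <-].
  have [ws sws wsE] := char_poly_split (M x).
  rewrite (counting_spectrum' wsE) lee_fin ler_nat size_filter.
  by rewrite (leq_trans (count_size _ _))// (leq_trans (size_undup _))// sws.
have [x [ws [wsE]]] := exists_generic; rewrite -size_filter_undup => /eqP uws.
apply: ereal_sup_ubound; exists x => //.
by rewrite (counting_spectrum' wsE) uws (size_char_roots wsE).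
Qed.

Lemma rank_attainedE x ws : char_poly (M x) = \prod_(w <- ws) ('X - w%:P) ->
  rank_attained a x <-> uniq (0 :: ws).
Proof.
move=> wsE; rewrite /rank_attained -[X in X <-> _]/(_ = _) rank_frame (counting_spectrum' wsE).
have sws := size_char_roots wsE.
rewrite -size_filter_undup sws; split=> [[/eqP]|/eqP ->//].
by rewrite eqr_nat.
Qed.

(** On the line from 1 to a point of E(a), only finitely many points leave E(a). *)
Lemma rank_attained_dense (e : K) : 0 < e ->
  exists2 x, rank_attained a x & ball (1 : A) e x.
Proof.
move=> e0.
have [x1 [ws [wsE uws]]] := exists_generic.
have XE x vs : char_poly (M x) = \prod_(v <- vs) ('X - v%:P) ->
    'X * char_poly (M x) = \prod_(v <- 0 :: vs) ('X - v%:P).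
  by move=> ->; rewrite big_cons subr0.
have sep1 : separable_poly ('X * char_poly (M x1)).
  by rewrite (XE _ _ wsE) separable_prod_XsubC.
have [D D0 HD] := separable_generic (M 1) sep1.
have e'0 : 0 < e / (`|x1 - 1| + 1) by rewrite divr_gt0// ltr_wpDl.
have [t te Dt] := exists_small_nonroot D0 e'0.
exists (1 + t *: (x1 - 1)).
  have [vs svs vsE] := char_poly_split (M (1 + t *: (x1 - 1))).
  apply/(rank_attainedE vsE); rewrite -separable_prod_XsubC -(XE _ _ vsE).
  have -> : M (1 + t *: (x1 - 1)) = M 1 + t *: (M x1 - M 1); last exact: HD.
  rewrite addrC (frame_mx_linear Fr) addrC; congr (_ + _ *: _).
  by rewrite addrC -scaleN1r (frame_mx_linear Fr) scaleN1r addrC.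
rewrite -ball_normE /= opprD addrA subrr add0r normrN normrZ.
have h : 0 < `|x1 - 1| + 1 by rewrite ltr_wpDl.
apply: (@le_lt_trans _ _ (`|t| * (`|x1 - 1| + 1))); last by rewrite -ltr_pdivlMr.
by rewrite ler_wpM2l// lerDl.
Qed.

Section Multiplicity.
Variable zs : seq K.
Hypothesis zsE : char_poly (M 1) = \prod_(z <- zs) ('X - z%:P).

(** For z = 0 the spectrum is not determined by the matrix through
    [frame_spectrum]; but an invertible a would make M(1) invertible. *)
Lemma spectrum_roots (z : K) : z \in zs -> spectrum a z.
Proof.
move=> zzs; rewrite /spectrum /=; have [z0|z0] := eqVneq z 0.
  rewrite z0 scale0r sub0r unitrN; apply/negP => /(frame_unit_mx Fr)/(_ di).
  by apply/negP; rewrite -root0_char_poly zsE root_prod_XsubC -z0.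
by rewrite -[X in _ - X]mul1r (frame_spectrum Fr)// zsE root_prod_XsubC.
Qed.

Lemma isolating_radius_roots (l r : K) : isolating_radius a l r ->
  forall z, z \in zs -> z != l -> r < `|l - z|.
Proof.
move=> [r0 isol] z zzs zl; rewrite real_ltNge ?normr_real ?gtr0_real//.
apply/negP => lz; move/eqP: zl; apply; apply: isol; split.
  exact: closure_ball_le.
exact: spectrum_roots.
Qed.

Lemma exists_isolating_radius (l : K) : exists r, isolating_radius a l r.
Proof.
have [r [r0 hr]] : exists r : K, 0 < r /\ forall z, z \in 0 :: zs -> z != l -> r < `|l - z|.
  elim: (0 :: zs) => [|z s [r [r0 IH]]]; first by exists 1.
  have [zl|zl] := eqVneq z l.
    by exists r; split=> // y; rewrite inE => /predU1P[->|]; [rewrite zl eqxx|exact: IH].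
  have h : 0 < `|l - z| / 2 by rewrite divr_gt0// normr_gt0 subr_eq0 eq_sym.
  have [e [e0 er eh]] := exists_pos_le2 r0 h.
  exists e; split=> // y; rewrite inE => /predU1P[-> _|ys yl].
    apply: le_lt_trans eh _; rewrite ltr_pdivrMr// mulr_natr mulr2n ltrDl.
    by rewrite normr_gt0 subr_eq0 eq_sym.
  exact: le_lt_trans er (IH y ys yl).
exists r; split=> // z [/closure_ball_ge clz sz]; apply: contrapT => zl.
apply: clz; apply: hr; last exact/eqP.
rewrite inE; have [//|z0 /=] := eqVneq z 0.
by move: sz; rewrite /spectrum /= -[a]mul1r (frame_spectrum Fr)// zsE root_prod_XsubC.
Qed.

(** The points of the spectrum of x a in the disk are the roots of the
    characteristic polynomial of M(x) there. Only the value 0 needs an argument: if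
    it lies in the disk then it is outside the spectrum of a, so a is invertible,
    and then so are x and x a. *)
Lemma counting_spectrum_near (l r : K) : l != 0 -> isolating_radius a l r ->
  \forall x \near (1 : A), rank_attained a x ->
    counting (spectrum (x * a) `&` ball (l : K^o) r) = (count_mem l zs)%:R%:E :> \bar R.
Proof.
move=> l0 isol; have [r0 isolE] := isol.
have := roots_count_near (fun i j => @frame_mx_cvg _ _ n p c d i j (1 : A) Fr) zsE r0
   (isolating_radius_roots isol).
apply: filterS => x hx xE.
have [ws sws wsE] := char_poly_split (M x).
have /= /andP[ws0 uws] := (rank_attainedE wsE).1 xE.
rewrite -(hx _ wsE) -size_filter -counting_seq ?filter_uniq//.
congr counting; apply/seteqP; split=> z.
  move=> [sz]; rewrite -ball_normE /= => lz; rewrite mem_filter lz /=.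
  have [z0|z0] := eqVneq z 0; last first.
    by move: sz; rewrite /spectrum /= (frame_spectrum Fr)// wsE root_prod_XsubC.
  exfalso; have au : a \is a GRing.unit.
    apply: contrapT => /negP au; move/eqP: l0; apply; apply/esym; apply: isolE.
    split; first by rewrite -z0; apply: closure_ball_le => //; exact: ltW.
    by rewrite /spectrum /= scale0r sub0r unitrN.
  move: sz; rewrite z0 /spectrum /= scale0r sub0r unitrN unitrMl//.
  suff -> : x \is a GRing.unit by [].
  by apply: (frame_unit Fr au); rewrite -[_ \in _]negbK -root0_char_poly wsE root_prod_XsubC.
rewrite /= mem_filter => /andP[lz zws]; split; last by rewrite -ball_normE.
rewrite /spectrum /= (frame_spectrum Fr) ?wsE ?root_prod_XsubC//.
by apply: contraNneq ws0 => <-.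
Qed.

(** Density of E(a) near 1 is what makes the multiplicity unique, and an isolating
    radius exists because the spectrum is finite. *)
Lemma multiplicity_frame (l : K) : l != 0 -> multiplicity l a = count_mem l zs.
Proof.
move=> l0; apply: xget_unique.
  move=> r /(counting_spectrum_near l0) /nbhs_ballP[e /= e0 he]; exists e => // x xE xe.
  exact: he.
move=> m; have [r isol] := exists_isolating_radius l.
move=> /(_ r isol)[e e0 he].
have /nbhs_ballP[e' /= e'0 he'] := counting_spectrum_near l0 isol.
have [e2 [e20 e2e e2e']] := exists_pos_le2 e0 e'0.
have [x xE xe2] := rank_attained_dense e20.
have := he x xE (le_ball e2e xe2).
rewrite he'//; last exact: le_ball xe2.
by move=> [] /eqP; rewrite eqr_nat => /eqP.
Qed.

(** Both sides sum the roots of the characteristic polynomial of M(1) with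
    multiplicity; the value 0 contributes nothing, whatever its multiplicity. *)
Lemma trace_minimal : trace a = \tr (M 1).
Proof.
rewrite (mxtrace_sum_roots zsE) /trace; pose s := [seq z <- undup zs | z != 0].
have us : uniq s by rewrite filter_uniq ?undup_uniq.
rewrite -(fsbig_widen [set` s]); last 2 first.
- by move=> z; rewrite /= mem_filter mem_undup => /andP[_ /spectrum_roots].
- move=> z [sz zs'] /=; have [->|z0] := eqVneq z 0; first by rewrite mul0r.
  case: zs'; rewrite /= mem_filter z0 mem_undup -root_prod_XsubC -zsE.
  by rewrite -(frame_spectrum Fr)// mul1r.
rewrite -fsbig_seq// big_filter -[RHS]big_undup_iterop_count big_mkcond.
apply: eq_bigr => z _; have [->|z0] := eqVneq z 0.
  by rewrite Monoid.iteropE iter_addr_0 mul0rn.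
by rewrite multiplicity_frame// mulr_natr Monoid.iteropE iter_addr_0.
Qed.

End Multiplicity.

End MinimalFrame.

Lemma trace_frame (R : realType) (A : banachAlgType R[i]) n (p c d : 'I_n -> A) :
  semiprime A -> frame p c d -> trace (\sum_i c i * d i) = \tr (frame_mx p c d 1).
Proof.
move=> sA /frame_minimal[m [p' [c' [d' [Fr' ci di <- <-]]]]].
have [zs _ zsE] := char_poly_split (frame_mx p' c' d' 1).
exact: (trace_minimal sA Fr' ci di zsE).
Qed.

(** * Equality of traces *)

(** X - f vanishes at every eigenvalue of M, so M - f(M) is nilpotent. *)
Lemma mxtrace_horner_mx (K : closedFieldType) n (M : 'M[K]_n.+1) (f : {poly K}) :
  (forall r, root (char_poly M) r -> 'X - r%:P %| f - r%:P) ->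
  \tr (horner_mx M f) = \tr M.
Proof.
move=> hf; have [rs srs rsE] := char_poly_split M.
have : (M - horner_mx M f) ^+ n.+1 = 0.
  rewrite -{1}[M](horner_mx_X M) -rmorphB -rmorphXn /=.
  suff /dvdpP[g ->] : char_poly M %| ('X - f) ^+ n.+1.
    by rewrite rmorphM /= Cayley_Hamilton mulr0.
  have -> : ('X - f) ^+ n.+1 = \prod_(r <- rs) ('X - f).
    by rewrite big_const_seq count_predT iter_mulr mulr1 srs.
  rewrite rsE !big_seq; apply: (big_ind2 (fun p q => p %| q)) => //.
    by move=> ? ? ? ?; apply: dvdp_mul.
  move=> r rrs; have -> : 'X - f = ('X - r%:P) - (f - r%:P) by ring.
  by rewrite dvdp_sub// hf// rsE root_prod_XsubC.
by move/mxtrace_nilpotent/eqP; rewrite raddfB subr_eq0 => /eqP.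
Qed.

(** Elements of the socle are algebraic, and polynomials that fix the eigenvalues
    preserve the trace. The node 0 makes f divisible by X, so that f(a) has a frame
    again. *)
Lemma socle_trace_calculus (R : realType) (A : banachAlgType R[i]) (a : A) :
  semiprime A -> socle A a -> exists ls : seq R[i],
    horner_alg a (\prod_(l <- ls) ('X - l%:P)) = 0 /\
    forall f : {poly R[i]}, (forall l, l \in 0 :: ls -> 'X - l%:P %| f - l%:P) ->
      trace (horner_alg a f) = trace a.
Proof.
move=> sA [s [hs ->]]; have [p [c [d [Fr <-]]]] := frame_exists sA hs.
move: (size s) p c d Fr => [|n] p c d Fr.
  rewrite big_ord0; exists [:: 0]; split.
    by rewrite big_seq1 rmorphB /= horner_algX rmorph0 subr0.
  move=> f /(_ 0 (mem_head _ _)); rewrite subr0 => /dvdpP[g].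
  rewrite subr0 => ->.
  by rewrite rmorphM /= horner_algX mulr0.
have [zs _ zsE] := char_poly_split (frame_mx p c d 1).
exists (0 :: zs); split.
  by rewrite big_cons -zsE subr0 mulrC; exact: frame_annihilator.
move=> f hf.
have := hf 0 (mem_head _ _); rewrite !subr0 => /dvdpP[g fE].
have [Fr' fa fM] := frame_horner Fr g.
rewrite fE -fa (trace_frame sA Fr') (trace_frame sA Fr) fM -fE.
apply: mxtrace_horner_mx => r; rewrite zsE root_prod_XsubC => rzs.
by apply: hf; rewrite !inE rzs !orbT.
Qed.

Theorem theorem3p2 (R : realType) (A : banachAlgType R[i]) (a b : A) :
  semisimple A -> socle A a -> socle A b -> rho a b = 0%E ->
  trace a = trace b.
Proof.
move=> /semisimple_semiprime sA soca socb /rho_superexponential q1.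
have [ls [ha ta]] := socle_trace_calculus sA soca.
have [ms [hb tb]] := socle_trace_calculus sA socb.
have [|f fab hf] := superexponential_common_calculus (undup_uniq (0 :: ls ++ ms)) _ ha hb q1.
  by move=> m mms; rewrite mem_undup inE mem_cat mms !orbT.
rewrite -(ta f) ?fab ?tb// => l hl; apply: hf; rewrite mem_undup;
  by move: hl; rewrite !inE mem_cat => /orP[->|->]; rewrite ?orbT.
Qed.
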